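(* Let $(V,\mathcal H,\iota,W)$ be an abelian functional theory with set of weights $\Omega$. Let $F$ be a facet of the convex polytope $\mathrm{conv}(\Omega)$, let $\Omega_F:=\Omega\cap F$, and let $\rho_*\in F$ be a density that does not belong to the convex hull of any $\dim F$ weights in $\Omega_F$. Let $\eta\in\overrightarrow{\mathrm{aff}(\Omega)}$ be inward-pointing, i.e. $\rho_*+\epsilon\eta\in\mathrm{conv}(\Omega)$ for all sufficiently small $\epsilon\ge 0$, and let $S\in V$ satisfy $\langle \alpha,S\rangle=0$ for all $\alpha\in\overrightarrow{\mathrm{aff}(F)}$ and $\langle\eta,S\rangle=1$. Then for any $\gamma\in\mathrm{aff}(F)$, $$\lim_{\epsilon\to0^+}\frac{\mathcal F_p(\rho_*+\epsilon\eta)-\mathcal F_p(\rho_* )}{\sqrt\epsilon}=-2\left[\sum_{\omega\in\Omega\setminus\Omega_F}\frac{\lVert\Pi_\omega W|\Phi\rangle\rVert^2}{\langle\omega,S\rangle-\langle\gamma,S\rangle}\right]^{1/2},$$ where $|\Phi\rangle$ is a normalized minimizer of the pure-state constrained search at $\rho_*$ (i.e. $\iota^*(|\Phi\rangle\langle\Phi|)=\rho_*$ and $\langle\Phi|W|\Phi\rangle=\mathcal F_p(\rho_* )$), chosen, if there are several minimizers, so that the right-hand side is minimized.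
   Context: A generalized functional theory is a tuple $(V,\mathcal H,\iota,W)$ with $V$ a finite-dimensional real vector space, $\mathcal H$ a finite-dimensional complex Hilbert space, $\iota:V\to i\mathfrak u(\mathcal H)$ a linear map into the Hermitian operators, and $W$ a Hermitian operator on $\mathcal H$. Density operators (ensemble states) $\Gamma$ are regarded as linear functionals on $i\mathfrak u(\mathcal H)$ via $A\mapsto\mathrm{Tr}(\Gamma A)$; the density map is the dual map $\iota^*:(i\mathfrak u(\mathcal H))^*\to V^*$, so $\langle\iota^*(\Gamma),v\rangle=\mathrm{Tr}(\Gamma\iota(v))$. $\mathcal P$ denotes the set of pure states (rank-one projectors). The pure functional is $\mathcal F_p(\rho)=\min\{\langle\Psi|W|\Psi\rangle:\ \|\Psi\|=1,\ \iota^*(|\Psi\rangle\langle\Psi|)=\rho\}$ on $\iota^*(\mathcal P)$. The theory is abelian if $[\iota(v),\iota(v')]=0$ for all $v,v'\in V$. A weight is a $\alpha\in V^*$ such that $\mathcal H_\alpha:=\{\psi:\iota(v)\psi=\langle\alpha,v\rangle\psi\ \forall v\}\neq0$; $\Omega$ is the set of weights, $\mathcal H=\bigoplus_{\omega\in\Omega}\mathcal H_\omega$ orthogonally, and $\Pi_\omega$ is the orthogonal projection onto $\mathcal H_\omega$. In the abelian case $\iota^*(\mathcal P)=\mathrm{conv}(\Omega)$. $\overrightarrow{A}$ denotes the translation space $\{a-b:a,b\in A\}$ of an affine set $A$. *)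

(* Defs.v *)
From HB Require Import structures.
From mathcomp Require Import all_boot all_order all_algebra.
From mathcomp Require Import complex.
From mathcomp Require Import all_classical all_reals all_analysis.

Set Implicit Arguments.
Unset Strict Implicit.
Unset Printing Implicit Defensive.

Import Order.TTheory GRing.Theory Num.Theory.
Local Open Scope ring_scope.
Local Open Scope classical_set_scope.

(* Conventions:
   - V  = 'cV[R]_d  (real column vectors; a basis of V is fixed),
   - V* = 'rV[R]_d  (real row vectors), pairing <a, v> = (a *m v) 0 0,
   - H  = 'cV[R[i]]_n (complex column vectors, standard inner product),
   - operators on H are matrices 'M[R[i]]_n. *)

Section Defs.
Variable R : realType.
Local Notation C := (R[i]).

Definition toC (a : R) : C := Complex a 0.

Definition adj m p (A : 'M[C]_(m, p)) : 'M[C]_(p, m) := (map_mx (@conjc R) A)^T.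

Definition herm n (A : 'M[C]_n) : Prop := adj A = A.

Definition vpair d (a : 'rV[R]_d) (v : 'cV[R]_d) : R := (a *m v) 0 0.

Definition Rlinear d n (iota : 'cV[R]_d -> 'M[C]_n) : Prop :=
  (forall u v, iota (u + v) = iota u + iota v) /\
  (forall (a : R) v, iota (a *: v) = toC a *: iota v).

Definition functional_theory d n (iota : 'cV[R]_d -> 'M[C]_n) (W : 'M[C]_n) :
  Prop :=
  [/\ Rlinear iota, (forall v, herm (iota v)) & herm W].

Definition abelian_theory d n (iota : 'cV[R]_d -> 'M[C]_n) : Prop :=
  forall v v', iota v *m iota v' = iota v' *m iota v.

Definition weight_space d n (iota : 'cV[R]_d -> 'M[C]_n) (alpha : 'rV[R]_d) :
  set 'cV[C]_n :=
  [set psi | forall v, iota v *m psi = toC (vpair alpha v) *: psi].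

Definition weights d n (iota : 'cV[R]_d -> 'M[C]_n) : set 'rV[R]_d :=
  [set alpha | exists2 psi, weight_space iota alpha psi & psi != 0].

Definition is_orth_proj n (P : 'M[C]_n) (U : set 'cV[C]_n) : Prop :=
  [/\ herm P, P *m P = P & forall psi, U psi <-> P *m psi = psi].

(* Pi_omega: the orthogonal projection onto H_omega (unique, hence
   well defined by choice) *)
Definition Proj d n (iota : 'cV[R]_d -> 'M[C]_n) (omega : 'rV[R]_d) : 'M[C]_n :=
  xget 0 [set P | is_orth_proj P (weight_space iota omega)].

Definition vnorm2 n (x : 'cV[C]_n) : R := complex.Re ((adj x *m x) 0 0).

Definition expect n (W : 'M[C]_n) (psi : 'cV[C]_n) : R :=
  complex.Re ((adj psi *m W *m psi) 0 0).

(* iota^*(|Psi><Psi|) = rho, i.e. Tr(|Psi><Psi| iota(v)) = <rho, v> for all v *)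
Definition pure_density d n (iota : 'cV[R]_d -> 'M[C]_n) (psi : 'cV[C]_n)
  (rho : 'rV[R]_d) : Prop :=
  forall v, \tr (psi *m adj psi *m iota v) = toC (vpair rho v).

(* the pure functional F_p (the min over the constraint set, written as inf) *)
Definition Fp d n (iota : 'cV[R]_d -> 'M[C]_n) (W : 'M[C]_n) (rho : 'rV[R]_d) : R :=
  inf [set expect W psi | psi in
        [set psi | vnorm2 psi = 1 /\ pure_density iota psi rho]].

Definition pure_minimizer d n (iota : 'cV[R]_d -> 'M[C]_n) (W : 'M[C]_n)
  (rho : 'rV[R]_d) (phi : 'cV[C]_n) : Prop :=
  [/\ vnorm2 phi = 1, pure_density iota phi rho & expect W phi = Fp iota W rho].

Definition convh d (A : set 'rV[R]_d) : set 'rV[R]_d :=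
  [set x | exists (k : nat) (p : 'I_k -> 'rV[R]_d) (l : 'I_k -> R),
     [/\ forall i, A (p i), forall i, 0 <= l i, \sum_i l i = 1
       & x = \sum_i l i *: p i]].

Definition affh d (A : set 'rV[R]_d) : set 'rV[R]_d :=
  [set x | exists (k : nat) (p : 'I_k -> 'rV[R]_d) (l : 'I_k -> R),
     [/\ forall i, A (p i), \sum_i l i = 1 & x = \sum_i l i *: p i]].

Definition trans_space d (A : set 'rV[R]_d) : set 'rV[R]_d :=
  [set x | exists2 a, A a & exists2 b, A b & x = a - b].

Definition subspace_dim d (U : set 'rV[R]_d) (k : nat) : Prop :=
  (exists s : seq 'rV[R]_d, [/\ {in s, forall x, U x}, free s & size s = k]) /\
  (forall s : seq 'rV[R]_d, {in s, forall x, U x} -> free s -> (size s <= k)%N).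

Definition affdim d (A : set 'rV[R]_d) (k : nat) : Prop :=
  subspace_dim (trans_space (affh A)) k.

Definition face d (P F : set 'rV[R]_d) : Prop :=
  exists (s : 'cV[R]_d) (c : R),
    (forall x, P x -> vpair x s <= c) /\
    F = P `&` [set x | vpair x s = c].

Definition facet d (P F : set 'rV[R]_d) : Prop :=
  [/\ face P F, F !=set0 &
      exists k, affdim F k /\ affdim P k.+1].

Definition conv_seq d (s : seq 'rV[R]_d) : set 'rV[R]_d :=
  convh [set x | x \in s].

End Defs.

(* Main.v *)
(** In a joint orthonormal eigenbasis of the operators [iota v], a pure state is
    a vector of real coordinates [x_j] (real and imaginary parts), its density
    is [\sum_j x_j^2 w_j] for weights [w_j], and the energy is a real quadratic
    form [E].  Let [h_j] be the height of [w_j] above the facet, measured by [S].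

    The genericity of [rho_s] and Caratheodory's theorem make the weights
    carried by any state of density [rho_s] span the facet affinely.  Hence
    small errors [O(eps)] in the density along the facet are corrected by
    changing the masses [x_j^2] on the support, which moves [x] by [O(eps)].

    Upper bound: starting from a minimizer [x], move mass [eps] off the facet by
    adding [sqrt eps * chi] with [\sum_j h_j chi_j^2 = 1], then correct.  The
    energy changes by [2 sqrt eps <chi, M x> + O(eps)], and the best [chi] gives
    [- sqrt (\sum_j (M x)_j^2 / h_j)] for the bracket.

    Lower bound: any state [x] of density [rho_s + eps eta] has
    [\sum_j h_j x_j^2 = eps], so its part off the facet is [O(sqrt eps)].  Near a
    minimizer [x0], removing that part and correcting yields a competitor at
    [rho_s], and Cauchy-Schwarz bounds the cross term.  States away from the
    minimizers have a larger energy or the wrong density, and compactness of the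
    sphere makes the estimates uniform. *)
Require Import Defs.
From HB Require Import structures.
From mathcomp Require Import all_boot all_order all_algebra.
From mathcomp Require Import complex.
From mathcomp Require Import all_classical all_reals all_analysis.
From mathcomp Require Import spectral.
From mathcomp Require Import ring lra.
Import Order.TTheory GRing.Theory Num.Theory.
Local Open Scope ring_scope.
Local Open Scope classical_set_scope.

Set Implicit Arguments.
Unset Strict Implicit.
Unset Printing Implicit Defensive.

(** * Quadratic forms and masses *)

Definition sqmx (R : realType) N (x : 'rV[R]_N) : 'rV[R]_N :=
  \row_j (x 0 j) ^+ 2.

Definition bform (R : realType) N (M : 'M[R]_N) (x y : 'rV[R]_N) : R :=
  (x *m M *m y^T) 0 0.

Definition gradsum (R : realType) N (M : 'M[R]_N) (h : 'cV[R]_N)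
    (x : 'rV[R]_N) : R :=
  \sum_j ((x *m M) 0 j) ^+ 2 / h j 0.

Lemma bformDl (R : realType) N (M : 'M[R]_N) x y z :
  bform M (x + y) z = bform M x z + bform M y z.
Proof. by rewrite /bform !mulmxDl mxE. Qed.

Lemma bformDr (R : realType) N (M : 'M[R]_N) x y z :
  bform M z (x + y) = bform M z x + bform M z y.
Proof. by rewrite /bform linearD /= mulmxDr mxE. Qed.

Lemma bformZl (R : realType) N (M : 'M[R]_N) a x y :
  bform M (a *: x) y = a * bform M x y.
Proof. by rewrite /bform -!scalemxAl mxE. Qed.

Lemma bformZr (R : realType) N (M : 'M[R]_N) a x y :
  bform M x (a *: y) = a * bform M x y.
Proof. by rewrite /bform linearZ /= -scalemxAr mxE. Qed.

Lemma bformE (R : realType) N (M : 'M[R]_N) x y :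
  bform M x y = \sum_j (x *m M) 0 j * y 0 j.
Proof. by rewrite /bform mxE; apply: eq_bigr => j _; rewrite [y^T _ _]mxE. Qed.

Lemma bformC (R : realType) N (M : 'M[R]_N) x y :
  M^T = M -> bform M x y = bform M y x.
Proof.
move=> MT; rewrite /bform.
by have -> : x *m M *m y^T = (y *m M *m x^T)^T;
  rewrite ?mxE// !trmx_mul trmxK MT mulmxA.
Qed.

Lemma bform_sqr (R : realType) N (M : 'M[R]_N) x z : M^T = M ->
  bform M (x + z) (x + z) =
  bform M x x + 2 * bform M z x + bform M z z.
Proof.
by move=> MT; rewrite !bformDl !bformDr (bformC x z MT); ring.
Qed.

Lemma bform_le (R : realType) N (M : 'M[R]_N) (x y : 'rV[R]_N) (a b : R) :
  (forall j, `|x 0 j| <= a) -> (forall j, `|y 0 j| <= b) ->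
  `|bform M x y| <= (\sum_i \sum_j `|M i j|) * (a * b).
Proof.
move=> xa yb; rewrite bformE (le_trans (ler_norm_sum _ _ _))//.
rewrite exchange_big/= mulr_suml; apply: ler_sum => j _.
rewrite normrM mxE.
have b0 : 0 <= b := le_trans (normr_ge0 _) (yb j).
apply: (@le_trans _ _ ((\sum_i `|M i j| * a) * b)).
  apply: ler_pM => //; rewrite (le_trans (ler_norm_sum _ _ _))//.
  by apply: ler_sum => i _; rewrite normrM mulrC ler_wpM2l.
by rewrite -mulr_suml mulrA.
Qed.

(** The root with the sign of [a] satisfies [(b - a) (b + a) = v a] and [|b + a| >= |a|], so the
    displacement is linear in [v] however small [a] is. This turns a correction of the masses into
    one of the same order on the coordinates. *)
Lemma sqrt_shift (R : realType) (a v : R) : 0 <= a ^+ 2 + v * a ->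
  exists b, b ^+ 2 = a ^+ 2 + v * a /\ `|b - a| <= `|v|.
Proof.
move=> ge0; have [->|a0] := eqVneq a 0.
  by exists 0; rewrite mulr0 addr0 subrr normr0.
pose s := Num.sqrt (a ^+ 2 + v * a).
have s0 : 0 <= s := sqrtr_ge0 _.
have s2 : s ^+ 2 = a ^+ 2 + v * a by rewrite sqr_sqrtr.
have [ap|an] := ltP 0 a.
  exists s; split => //.
  have e : (s - a) * (s + a) = v * a by rewrite -subr_sqr s2; ring.
  have sa : 0 < s + a by apply: ltr_wpDl.
  rewrite -(ler_pM2r sa) -[X in _ * X <= _](gtr0_norm sa) -normrM e normrM.
  by rewrite ler_wpM2l// gtr0_norm// lerDr.
have {a0}an : a < 0 by rewrite lt_neqAle a0.
exists (- s); rewrite sqrrN; split => //.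
have e : (- s - a) * (s - a) = - (v * a).
  have : s ^+ 2 - a ^+ 2 = v * a by rewrite s2; ring.
  by move=> <-; ring.
have sa : 0 < s - a by rewrite subr_gt0; exact: lt_le_trans s0.
rewrite -(ler_pM2r sa) -[X in _ * X <= _](gtr0_norm sa) -normrM e normrN normrM.
by rewrite ler_wpM2l// ltr0_norm// lerDr.
Qed.

(** Corrections that are small against this gap keep the masses on the support of [x] nonnegative.
    The cap at [1] covers [x = 0]. *)
Lemma nonzero_gap (R : realType) N (x : 'rV[R]_N) :
  exists2 m : R, 0 < m & forall j, x 0 j != 0 -> m <= `|x 0 j|.
Proof.
exists (\big[Num.min/1]_(j | x 0 j != 0) `|x 0 j|).
  by apply/bigmin_gtP; split => // j; rewrite normr_gt0.
by move=> j xj; exact: bigmin_le_cond.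
Qed.

(** * Two-sided expansion at a facet *)

(* Abstract form of the situation at a facet: the rows of [B] are the weights in
   homogeneous coordinates, [o] reads off the total mass, [s] is the height
   above the facet, [r] is the density on the facet and [e] the direction. *)
Record facet_data (R : realType) N D (B : 'M[R]_(N, D)) (o s : 'cV[R]_D)
    (r e : 'rV[R]_D) : Prop := FacetData {
  fd_mass : B *m o = const_mx 1;
  fd_ge0 : forall j, 0 <= (B *m s) j 0;
  fd_base : r *m s = 0;
  fd_dir : e *m s = 1%:M;
  fd_dir_mass : e *m o = 0;
  fd_dir_sub : (e <= B)%MS;
  fd_span : forall (x : 'rV[R]_N) (tau : 'rV[R]_D), sqmx x *m B = r ->
    (tau <= B)%MS -> tau *m s = 0 -> (tau <= diag_mx x *m B)%MS }.

(** Pairing the density with [s] kills [r] and sends [e] to 1. Since the heights are nonnegative,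
    this forces the part of [x] off the facet to be of order [sqrt t]. *)
Lemma sqmx_height (R : realType) N D (B : 'M[R]_(N, D)) o s r e
    (t : R) (x : 'rV[R]_N) : facet_data B o s r e ->
  sqmx x *m B = r + t *: e -> \sum_j (B *m s) j 0 * (x 0 j) ^+ 2 = t.
Proof.
move=> fd xB; have : (sqmx x *m B *m s) 0 0 = t.
  rewrite xB mulmxDl (fd_base fd) add0r -scalemxAl (fd_dir fd).
  by rewrite !mxE mulr1.
move=> <-; rewrite -mulmxA [RHS]mxE; apply: eq_bigr => j _.
by rewrite [sqmx _ _ _]mxE mulrC.
Qed.

Lemma sqmx_on_facet (R : realType) N D (B : 'M[R]_(N, D)) o s r e
    (x : 'rV[R]_N) j : facet_data B o s r e ->
  sqmx x *m B = r -> (B *m s) j 0 != 0 -> x 0 j = 0.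
Proof.
move=> fd xB hj; have : \sum_j (B *m s) j 0 * (x 0 j) ^+ 2 = 0.
  by apply: (sqmx_height fd); rewrite scale0r addr0.
move/psumr_eq0P => /(_ _ j isT) H; apply/eqP; rewrite -sqrf_eq0.
move: H => /(_ _)/eqP; rewrite mulf_eq0 (negbTE hj)/=; apply.
by move=> i _; rewrite mulr_ge0 ?sqr_ge0 ?(fd_ge0 fd).
Qed.

(** This is the equality case of Cauchy-Schwarz for the linear form [bform M x] under the constraint
    of unit mean height: [chi] is the best direction in which to leave the facet. *)
Lemma optimal_escape (R : realType) N D (M : 'M[R]_N) (B : 'M[R]_(N, D)) o s r e
    (x : 'rV[R]_N) : facet_data B o s r e ->
  exists chi : 'rV[R]_N,
    [/\ \sum_j (B *m s) j 0 * (chi 0 j) ^+ 2 = 1,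
        forall j, (B *m s) j 0 = 0 -> chi 0 j = 0
      & bform M x chi = - Num.sqrt (gradsum M (B *m s) x)].
Proof.
move=> fd; set h := B *m s; set G := gradsum M h x.
have h0 j : 0 <= h j 0 by exact: (fd_ge0 fd).
have Gj j : 0 <= ((x *m M) 0 j) ^+ 2 / h j 0.
  by rewrite mulr_ge0 ?sqr_ge0 ?invr_ge0.
have G0 : 0 <= G by apply: sumr_ge0.
(* If [G = 0], normalizing by [sqrt G] is impossible. Any single coordinate of positive height then
   serves, and one exists because [e] is a combination of the rows of [B] and has height 1. *)
have [Geq|Gneq] := eqVneq G 0.
  have [j hj] : exists j, h j 0 != 0.
    apply: contrapT => /forallNP hn.
    have h_eq0 : h = 0.
      by apply/colP => j; move: (hn j) => /negP; rewrite negbK [RHS]mxE => /eqP.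
    have /submxP[u eu] := fd_dir_sub fd; have := fd_dir fd.
    rewrite eu -mulmxA -/h h_eq0 mulmx0 => /matrixP/(_ 0 0); rewrite !mxE => /eqP.
    by rewrite eq_sym oner_eq0.
  have hjp : 0 < h j 0 by rewrite lt_neqAle eq_sym hj h0.
  pose c := (Num.sqrt (h j 0))^-1; pose chi : 'rV[R]_N := \row_i (c * (i == j)%:R).
  have chiE i : chi 0 i = c * (i == j)%:R by rewrite mxE.
  exists chi; split.
  - rewrite (bigD1 j)//= big1 ?addr0 => [|i ij].
      by rewrite chiE eqxx mulr1 exprVn sqr_sqrtr// divff.
    by rewrite chiE (negbTE ij) mulr0 expr0n mulr0.
  - move=> i hi; rewrite chiE; case: eqP => [ij|]; last by rewrite mulr0.
    by rewrite -ij hi eqxx in hj.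
  - rewrite Geq sqrtr0 oppr0 bformE (bigD1 j)//= big1 => [|i ij].
      have /psumr_eq0P/(_ j isT)/eqP : \sum_j ((x *m M) 0 j) ^+ 2 / h j 0 = 0.
        exact: Geq.
      rewrite mulf_eq0 invr_eq0 (negbTE hj) orbF sqrf_eq0 => /(_ _)/eqP ->//.
      by rewrite mul0r addr0.
    by rewrite chiE (negbTE ij) !mulr0.
pose g := Num.sqrt G; have g0 : 0 < g by rewrite sqrtr_gt0 lt_neqAle eq_sym Gneq.
have g2 : g ^+ 2 = G by rewrite sqr_sqrtr.
(* The Lagrange condition makes [chi] proportional to the gradient divided by the height. Where the
   height is 0, the convention that the inverse of 0 is 0 gives the required value 0. *)
pose chi : 'rV[R]_N := \row_j (- ((x *m M) 0 j / (h j 0 * g))).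
have chiE j : chi 0 j = - ((x *m M) 0 j / (h j 0 * g)) by rewrite mxE.
exists chi; split.
- have -> : 1 = G / g ^+ 2 by rewrite g2 divff.
  rewrite /G /gradsum mulr_suml; apply: eq_bigr => j _; rewrite chiE sqrrN.
  have [->|hj] := eqVneq (h j 0) 0; first by rewrite invr0 mulr0 !mul0r.
  by field; rewrite hj gt_eqF.
- by move=> j hj; rewrite chiE hj mul0r invr0 mulr0 oppr0.
- rewrite -/g; have -> : - g = - (G / g) by rewrite -g2 expr2 mulfK// gt_eqF.
  rewrite bformE /G /gradsum mulr_suml -sumrN; apply: eq_bigr => j _; rewrite chiE.
  have [->|hj] := eqVneq (h j 0) 0; first by rewrite mul0r invr0 !mulr0 oppr0 mulr0 mul0r oppr0.
  by field; rewrite hj gt_eqF.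
Qed.

(** The competitor is [x + sqrt t * (chi + sqrt t * v)]: [chi] carries mass off the facet, and [v]
    restores the density exactly by shifting masses on the support of [x]. *)
Lemma upper_bound (R : realType) N D (M : 'M[R]_N) (B : 'M[R]_(N, D)) o s r e
    (x : 'rV[R]_N) : facet_data B o s r e -> M^T = M -> sqmx x *m B = r ->
  exists C t0 : R, [/\ 0 <= C, 0 < t0 & forall t, 0 < t -> t < t0 ->
    exists2 y, sqmx y *m B = r + t *: e &
      bform M y y <= bform M x x -
        2 * Num.sqrt t * Num.sqrt (gradsum M (B *m s) x) + C * t].
Proof.
move=> fd MT xB.
have [chi [chi1 chi0 chig]] := optimal_escape M x fd.
(* The escaped mass has height 1, as does [e], so the difference is tangent to the facet and
   [fd_span] yields mass changes [u j * x j] that compensate it. *)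
have /submxP[u tauE] : (e - sqmx chi *m B <= diag_mx x *m B)%MS.
  apply: (fd_span fd xB).
    by rewrite addmx_sub ?(fd_dir_sub fd)// eqmx_opp submxMl.
  rewrite mulmxBl (fd_dir fd) -mulmxA; apply/matrixP => i j.
  rewrite !ord1 !mxE eqxx -chi1 -sumrB big1// => l _.
  by rewrite [sqmx _ _ _]mxE [X in _ - X]mulrC subrr.
have [m m0 xm] := nonzero_gap x.
pose U := \sum_j `|u 0 j|; pose V := \sum_j `|chi 0 j|; pose X := \sum_j `|x 0 j|.
have U0 : 0 <= U by apply: sumr_ge0.
have V0 : 0 <= V by apply: sumr_ge0.
have X0 : 0 <= X by apply: sumr_ge0.
have le_sum (f : 'rV[R]_N) j : `|f 0 j| <= \sum_j `|f 0 j|.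
  by rewrite (bigD1 j)//= lerDl sumr_ge0.
pose K := \sum_i \sum_j `|M i j|.
have K0 : 0 <= K by apply: sumr_ge0 => i _; apply: sumr_ge0.
(* The two summands bound [2 <v, M x>] and [<z, M z>] with [z = chi + sqrt t * v]. The bound
   [m / (U + 1)] on [t] gives [|t u_j| <= |x_j|] on the support, so the corrected masses are
   nonnegative. *)
exists (2 * (K * (U * X)) + K * ((V + U) * (V + U))), (Num.min 1 (m / (U + 1))).
have U10 : 0 < U + 1 by rewrite ltr_wpDl.
split; first by rewrite addr_ge0 ?mulr_ge0 ?addr_ge0.
  by rewrite lt_min ltr01 divr_gt0.
move=> t t0; rewrite lt_min => /andP[t1]; rewrite ltr_pdivlMr// => tm.
have tn : 0 <= t := ltW t0.
have /fin_all_exists[b bP] : forall j, exists b,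
    b ^+ 2 = (x 0 j) ^+ 2 + (t * u 0 j) * x 0 j /\ `|b - x 0 j| <= `|t * u 0 j|.
  move=> j; apply: sqrt_shift; have [->|xj] := eqVneq (x 0 j) 0.
    by rewrite mulr0 expr0n addr0.
  have tum : `|t * u 0 j| <= `|x 0 j|.
    apply: le_trans (xm _ xj); rewrite normrM gtr0_norm//.
    apply: le_trans (ltW tm); rewrite ler_wpM2l// (le_trans (le_sum u j))//.
    by rewrite lerDl.
  rewrite -real_normK ?num_real// -lerBlDl sub0r.
  apply: lerNnormlW; rewrite normrM expr2.
  by rewrite ler_wpM2r.
pose rt := Num.sqrt t.
have rt2 : rt ^+ 2 = t by rewrite sqr_sqrtr.
have rt0 : 0 < rt by rewrite sqrtr_gt0.
have rt1 : rt <= 1 by rewrite -sqrtr1 ler_wsqrtr// ltW.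
pose v := \row_j ((b j - x 0 j) / rt ^+ 2).
have vU j : `|v 0 j| <= U.
  rewrite mxE rt2 normrM normfV (gtr0_norm t0) ler_pdivrMr//.
  rewrite (le_trans (bP j).2)// normrM (gtr0_norm t0) mulrC.
  by rewrite ler_wpM2r// le_sum.
pose z := chi + rt *: v; pose y := x + rt *: z.
have yj j : y 0 j = b j + rt * chi 0 j.
  by rewrite !mxE; field; rewrite gt_eqF.
(* [b] lives on the facet and [chi] off it, so squaring [b + sqrt t * chi] produces no cross term
   and the density is exactly [r + t *: e]. *)
have bchi j : b j * chi 0 j = 0.
  have [/chi0->|hj] := eqVneq ((B *m s) j 0) 0; first by rewrite mulr0.
  have xj := sqmx_on_facet fd xB hj.
  have [/eqP + _] := bP j; rewrite xj mulr0 expr0n addr0 sqrf_eq0 => /eqP ->.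
  by rewrite mul0r.
exists y.
  have -> : sqmx y = sqmx x + t *: (u *m diag_mx x + sqmx chi).
    apply/rowP => j; rewrite mxE yj.
    have -> : (b j + rt * chi 0 j) ^+ 2 =
      (b j) ^+ 2 + rt ^+ 2 * (chi 0 j) ^+ 2 + 2 * rt * (b j * chi 0 j) by ring.
    rewrite bchi (bP j).1 mul_mx_diag rt2 !mxE; ring.
  rewrite mulmxDl xB -scalemxAl mulmxDl -mulmxA -tauE; congr (_ + _ *: _).
  by rewrite subrK.
rewrite bform_sqr// bformZl bformZl bformZr /z bformDl (bformC chi)// chig bformZl.
rewrite -/z -/rt.
have vx : bform M v x <= K * (U * X).
  by rewrite (le_trans (ler_norm _))// bform_le.
have zz : bform M z z <= K * ((V + U) * (V + U)).
  rewrite (le_trans (ler_norm _))//.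
  have zj j : `|z 0 j| <= V + U.
    rewrite !mxE (le_trans (ler_normD _ _))// lerD// normrM (gtr0_norm rt0).
    by have := vU j; rewrite mxE => {}vU; rewrite -[U]mul1r ler_pM// ltW.
  exact: bform_le.
rewrite -rt2; set g := Num.sqrt _.
have -> : bform M x x + 2 * (rt * (- g + rt * bform M v x)) +
  rt * (rt * bform M z z) =
  bform M x x - 2 * rt * g + (2 * bform M v x + bform M z z) * rt ^+ 2 by ring.
rewrite lerD2l ler_wpM2r ?sqr_ge0// lerD//.
by rewrite ler_pM2l.
Qed.

(* Weighted AM-GM, [g p >= - (h p^2 s / a + g^2 a / (h s)) / 2] with
   [a = sqrt t], in place of the Cauchy-Schwarz inequality. *)
Lemma gradient_pairing_ge (R : realType) N (g p h : 'I_N -> R) (t s : R) :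
  (forall j, 0 <= h j) -> (forall j, h j = 0 -> p j = 0) ->
  \sum_j h j * p j ^+ 2 = t -> 0 < t -> 0 < s -> \sum_j g j ^+ 2 / h j <= s ^+ 2 ->
  - (Num.sqrt t * s) <= \sum_j g j * p j.
Proof.
move=> h0 hp pt t0 s0 Gs; pose a := Num.sqrt t.
have a0 : 0 < a by rewrite sqrtr_gt0.
have a2 : a ^+ 2 = t by rewrite sqr_sqrtr// ltW.
have le1 : - ((\sum_j h j * p j ^+ 2) * (s / a) + (\sum_j g j ^+ 2 / h j) * (a / s)) / 2
    <= \sum_j g j * p j.
  rewrite !mulr_suml -big_split/= -sumrN mulr_suml; apply: ler_sum => j _.
  have [hj|hj] := eqVneq (h j) 0.
    by rewrite (hp _ hj) hj invr0 expr0n/= !(mulr0, mul0r) addr0 oppr0 mul0r.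
  have hjp : 0 < h j by rewrite lt_neqAle eq_sym hj h0.
  rewrite -subr_ge0.
  have -> : g j * p j - - (h j * p j ^+ 2 * (s / a) + g j ^+ 2 / h j * (a / s)) / 2 =
     (h j * p j * s + g j * a) ^+ 2 / (2 * h j * a * s).
    by field; rewrite !gt_eqF.
  by rewrite divr_ge0 ?sqr_ge0// !mulr_ge0// ltW.
apply: le_trans le1; rewrite pt -/a.
have -> : - (a * s) = - (t * (s / a) + s ^+ 2 * (a / s)) / 2.
  by rewrite -a2; field; rewrite !gt_eqF.
rewrite !mulNr lerN2 ler_pM2r ?invr_gt0// lerD2l ler_wpM2r//.
by rewrite divr_ge0// ltW.
Qed.

(** Split [x = a + p] into its parts on and off the facet, and correct [a] to a state [y] of density
    [r], whose energy is at least that of [x0]. The rest [z = x - y] is [p] up to order [t], and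
    [<p, M x0>] is the only contribution of order [sqrt t] that does not shrink with [k]. The
    correction is expressed through the support of [x0], which makes all constants independent of
    [x]. *)
Lemma lower_bound_near (R : realType) N D (M : 'M[R]_N) (B : 'M[R]_(N, D)) o s r e
    (x0 : 'rV[R]_N) (d : R) : facet_data B o s r e -> M^T = M ->
  sqmx x0 *m B = r -> (forall y, sqmx y *m B = r -> bform M x0 x0 <= bform M y y) ->
  0 < d ->
  exists2 k : R, 0 < k & forall t (x : 'rV[R]_N), 0 < t -> t < k ->
    (forall j, `|x 0 j - x0 0 j| < k) -> sqmx x *m B = r + t *: e ->
    bform M x0 x0 - Num.sqrt t * (2 * Num.sqrt (gradsum M (B *m s) x0) + d)
      <= bform M x x.
Proof.
move=> fd MT x0B x0min d0.
pose h j := (B *m s) j 0.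
have h0 j : 0 <= h j by exact: (fd_ge0 fd).
have [m m0 xm] := nonzero_gap x0.
(* A fixed linear solver for the correction: since [p_i ^ 2 <= t / h_i], its output on
   [t *: e - sqmx p *m B] is bounded entrywise by [t * c]. *)
pose X := pinvmx (diag_mx x0 *m B).
pose c := \sum_j `|(e *m X) 0 j| + \sum_i \sum_j `|(B *m X) i j| / h i.
pose cp := \sum_i Num.sqrt (h i)^-1.
pose X0 := \sum_j `|x0 0 j|.
pose K := \sum_i \sum_j `|M i j|.
have K0 : 0 <= K by apply: sumr_ge0 => i _; apply: sumr_ge0.
have X00 : 0 <= X0 by apply: sumr_ge0.
have cp0 : 0 <= cp by apply: sumr_ge0 => i _; exact: sqrtr_ge0.
have c0 : 0 <= c.
  rewrite addr_ge0//; apply: sumr_ge0 => // i _; apply: sumr_ge0 => j _.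
  by rewrite divr_ge0.
(* [C1] collects the errors of order [t], from [<q, M y>] and [<z, M z>]; [C2] is the factor of
   [sqrt t * k] in the bound for [2 <p, M (y - x0)>]. *)
pose C1 := 2 * (K * (2 * c * (X0 + 1 + 2 * c))) + K * ((cp + 2 * c) * (cp + 2 * c)).
pose C2 := 2 * (K * (cp * (1 + 2 * c))).
have C10 : 0 <= C1 by repeat first [done | apply: mulr_ge0 | apply: addr_ge0].
have C20 : 0 <= C2 by repeat first [done | apply: mulr_ge0 | apply: addr_ge0].
have C120 : 0 < C1 + C2 + 1 by rewrite ltr_wpDl// addr_ge0.
(* The bound [m / 2] keeps [|a_j|] above [|x0_j| / 2] on the support of [x0], the next one gives
   [|u_j| <= |x0_j| / 4], and the last makes [sqrt k * (C1 + C2)] at most [d / 2]. *)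
pose k := Num.min (Num.min 1 (m / 2))
  (Num.min (m / (4 * (c + 1))) ((d / (2 * (C1 + C2 + 1))) ^+ 2)).
have k0 : 0 < k.
  rewrite !lt_min ltr01 divr_gt0//=; apply/andP; split.
    by rewrite divr_gt0// mulr_gt0// ltr_wpDl.
  by rewrite exprn_gt0// divr_gt0// mulr_gt0.
exists k => // t x t0 tk xk xB.
have : k <= k by [].
rewrite {2}/k !le_min => /andP[/andP[k1 km]] /andP[kc kd].
have tn : 0 <= t := ltW t0.
have rowB (f g : 'rV[R]_N) j : (f - g) 0 j = f 0 j - g 0 j by rewrite !mxE.
pose a : 'rV[R]_N := \row_j (if h j == 0 then x 0 j else 0).
pose p : 'rV[R]_N := \row_j (if h j == 0 then 0 else x 0 j).
have aE j : a 0 j = if h j == 0 then x 0 j else 0 by rewrite mxE.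
have pE j : p 0 j = if h j == 0 then 0 else x 0 j by rewrite mxE.
have x0h j : h j != 0 -> x0 0 j = 0 by exact: sqmx_on_facet fd x0B.
have hp2 : \sum_j h j * p 0 j ^+ 2 = t.
  rewrite -(sqmx_height fd xB); apply: eq_bigr => j _; rewrite pE -/(h j).
  by case: eqP => [->|//]; rewrite !mul0r.
have p2 j : p 0 j ^+ 2 <= t / h j.
  have [hj|hj] := eqVneq (h j) 0; first by rewrite pE hj eqxx expr0n invr0 mulr0.
  have hjp : 0 < h j by rewrite lt_neqAle eq_sym hj h0.
  rewrite ler_pdivlMr// -hp2 mulrC (bigD1 j)//= lerDl sumr_ge0// => i _.
  by rewrite mulr_ge0// sqr_ge0.
pose rt := Num.sqrt t.
have rt2 : rt ^+ 2 = t by rewrite sqr_sqrtr.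
have rt0 : 0 < rt by rewrite sqrtr_gt0.
have rt1 : rt <= 1 by rewrite -sqrtr1 ler_wsqrtr// ltW// (lt_le_trans tk).
have pcp j : `|p 0 j| <= rt * cp.
  rewrite -sqrtr_sqr (le_trans (ler_wsqrtr (p2 j)))// sqrtrM// ler_wpM2l ?sqrtr_ge0//.
  by rewrite /cp (bigD1 j)//= lerDl sumr_ge0// => i _; exact: sqrtr_ge0.
have sqa : sqmx a = sqmx x - sqmx p.
  apply/rowP => j; rewrite !mxE; case: eqP => _; by rewrite expr0n/= (subr0, subrr).
(* [tau] is the excess of the density of [a] over [r]. Its height is zero because [p] carries all
   the height of [x]. *)
pose tau := t *: e - sqmx p *m B; pose u := tau *m X.
have tauE : tau = u *m (diag_mx x0 *m B).
  rewrite /u mulmxKpV//; apply: (fd_span fd x0B).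
    by rewrite addmx_sub ?scalemx_sub ?(fd_dir_sub fd)// eqmx_opp submxMl.
  rewrite mulmxBl -scalemxAl (fd_dir fd) -mulmxA; apply/matrixP => i j.
  rewrite !ord1 !mxE eqxx mulr1 -{1}hp2 -sumrB big1// => l _.
  by rewrite [sqmx _ _ _]mxE [X in _ - X]mulrC subrr.
have uc j : `|u 0 j| <= t * c.
  have -> : u 0 j = t * (e *m X) 0 j - (sqmx p *m (B *m X)) 0 j.
    by rewrite /u mulmxBl -scalemxAl -mulmxA mxE [X in X + _]mxE [X in _ + X]mxE.
  rewrite mulrDr.
  rewrite (le_trans (ler_normB _ _))// lerD//.
    rewrite normrM gtr0_norm// ler_wpM2l//.
    by rewrite (bigD1 j)//= lerDl sumr_ge0.
  rewrite mxE (le_trans (ler_norm_sum _ _ _))// mulr_sumr; apply: ler_sum => i _.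
  rewrite [sqmx _ _ _]mxE normrM ger0_norm ?sqr_ge0//.
  apply: (@le_trans _ _ (t / h i * `|(B *m X) i j|)); first by rewrite ler_wpM2r.
  rewrite -mulrA ler_wpM2l// mulrC (bigD1 j)//= lerDl sumr_ge0// => l _.
  by rewrite divr_ge0.
have half j : x0 0 j != 0 -> `|x0 0 j| / 2 <= `|a 0 j|.
  move=> xj; have hj : h j == 0 by apply: contraNT xj => /x0h ->.
  have := xk j; have := xm _ xj; rewrite aE hj => mx xkj.
  have := ler_distD (x 0 j) (x0 0 j) 0; rewrite !subr0 distrC => tri.
  lra.
have a0 j : x0 0 j != 0 -> a 0 j != 0.
  move=> xj; rewrite -normr_gt0 (lt_le_trans _ (half _ xj))//.
  by rewrite divr_gt0// normr_gt0.
(* The mass change [- u_j x0_j] is rewritten as a multiple of [a_j], the form that [sqrt_shift]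
   accepts; the quotient [x0_j / a_j] is at most 2 in modulus. *)
pose v j := - (u 0 j * (x0 0 j / a 0 j)).
have va j : v j * a 0 j = - (u 0 j * x0 0 j).
  rewrite /v; have [->|xj] := eqVneq (x0 0 j) 0; first by rewrite !mul0r !mulr0 oppr0 mul0r.
  by rewrite mulNr -mulrA divfK// a0.
have vc j : `|v j| <= 2 * c * t.
  rewrite /v normrN normrM [leRHS](_ : _ = (t * c) * 2); last by ring.
  apply: ler_pM => //.
  have [->|xj] := eqVneq (x0 0 j) 0; first by rewrite mul0r normr0.
  rewrite normrM normfV ler_pdivrMr ?normr_gt0 ?a0//.
  by have := half _ xj; lra.
have /fin_all_exists[b bP] : forall j, exists b,
    b ^+ 2 = (a 0 j) ^+ 2 + v j * a 0 j /\ `|b - a 0 j| <= `|v j|.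
  move=> j; apply: sqrt_shift; rewrite va.
  have [->|xj] := eqVneq (x0 0 j) 0; first by rewrite mulr0 subr0 sqr_ge0.
  have xp : 0 < `|x0 0 j| by rewrite normr_gt0.
  have uj : `|u 0 j| <= `|x0 0 j| / 4.
    apply: le_trans (uc j) _; apply: (@le_trans _ _ (m / 4)); last first.
      by rewrite ler_pM2r// xm.
    have : t * (c + 1) <= m / 4.
      have := le_trans (ltW tk) kc; rewrite ler_pdivlMr ?mulr_gt0 ?ltr_wpDl//.
      by lra.
    by apply: le_trans; rewrite ler_pM2l// lerDl.
  rewrite subr_ge0 (le_trans (ler_norm _))// normrM.
  rewrite -(real_normK (num_real (a 0 j))).
  have xh : 0 <= `|x0 0 j| / 2 by rewrite divr_ge0.
  rewrite expr2; apply: le_trans (ler_pM xh xh (half _ xj) (half _ xj)).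
  by rewrite [leRHS](_ : _ = `|x0 0 j| / 4 * `|x0 0 j|); [rewrite ler_pM2r|field].
pose y : 'rV[R]_N := \row_j b j.
have yE j : y 0 j = b j by rewrite mxE.
have yB : sqmx y *m B = r.
  have -> : sqmx y = sqmx a - u *m diag_mx x0.
    apply/rowP => j; rewrite mul_mx_diag [LHS]mxE yE (bP j).1 va.
    by rewrite rowB [sqmx a _ _]mxE [X in _ = _ - X]mxE.
  rewrite mulmxBl -mulmxA -tauE sqa mulmxBl xB /tau opprB addrA subrK.
  by rewrite addrK.
have Ey := x0min _ yB.
pose q := a - y; pose z := q + p.
have xE : x = y + z.
  rewrite /z /q addrA [y + _]addrC subrK; apply/rowP => j.
  by rewrite [RHS]mxE aE pE; case: eqP; rewrite (addr0, add0r).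
have qc j : `|q 0 j| <= 2 * c * t.
  by rewrite rowB yE distrC (le_trans (bP j).2).
have ct_k : 2 * c * t <= 2 * c * k by rewrite ler_wpM2l ?mulr_ge0// ltW.
have yx0 j : `|(y - x0) 0 j| <= (1 + 2 * c) * k.
  have -> : (y - x0) 0 j = (a 0 j - x0 0 j) - q 0 j.
    by rewrite !rowB; ring.
  rewrite (le_trans (ler_normB _ _))// mulrDl mul1r lerD ?(le_trans (qc j))//.
  rewrite aE; case: eqP => [_|/eqP hj]; first exact: ltW.
  by rewrite x0h// subrr normr0 ltW.
have yX j : `|y 0 j| <= X0 + 1 + 2 * c.
  have -> : y 0 j = x0 0 j + (y - x0) 0 j by rewrite rowB addrC subrK.
  rewrite (le_trans (ler_normD _ _))// -addrA lerD//.
    by rewrite /X0 (bigD1 j)//= lerDl sumr_ge0.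
  by rewrite (le_trans (yx0 j))// ler_piMr// addr_ge0// mulr_ge0.
have t_rt : t <= rt by rewrite -rt2 expr2 ler_piMr// ltW.
have zc j : `|z 0 j| <= rt * (cp + 2 * c).
  rewrite mxE (le_trans (ler_normD _ _))// addrC mulrDr lerD//.
  by rewrite (le_trans (qc j))// mulrC ler_wpM2r// mulr_ge0.
rewrite xE bform_sqr// bformDl.
have -> : bform M p y = bform M p x0 + bform M p (y - x0).
  by rewrite -bformDr addrC subrK.
set g := Num.sqrt (gradsum _ _ _); pose w := Num.sqrt k.
have G0 : 0 <= gradsum M (B *m s) x0.
  by apply: sumr_ge0 => j _; rewrite divr_ge0 ?sqr_ge0// (fd_ge0 fd).
have g0 : 0 <= g by exact: sqrtr_ge0.
have b1 := lerNnormlW (bform_le M qc yX).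
have b2 := lerNnormlW (bform_le M pcp yx0).
have b3 := lerNnormlW (bform_le M zc zc).
(* [g] may vanish, whereas [gradient_pairing_ge] asks for a positive bound. Adding [d / 4] costs
   [d / 2] after doubling and leaves [d / 2] for the other errors. *)
have b4 : - (rt * (g + d / 4)) <= bform M p x0.
  rewrite bformC// bformE; apply: (gradient_pairing_ge h0) => //.
  - by move=> j hj; rewrite pE hj eqxx.
  - by rewrite ltr_wpDl// divr_gt0.
  - have d4 : 0 <= d / 4 by rewrite divr_ge0// ltW.
    by rewrite -[leLHS](sqr_sqrtr G0) -/g ler_pXn2r ?nnegrE ?lerDl ?addr_ge0.
have wd : w * (C1 + C2) <= d / 2.
  have : w <= d / (2 * (C1 + C2 + 1)).
    rewrite -[leRHS]ger0_norm ?divr_ge0 ?mulr_ge0// ?(ltW d0) ?(ltW C120)//.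
    by rewrite -sqrtr_sqr ler_wsqrtr.
  rewrite ler_pdivlMr ?mulr_gt0// => wd.
  have w0 : 0 <= w by exact: sqrtr_ge0.
  by lra.
have rtw : rt <= w by rewrite ler_wsqrtr// ltW.
have w2 : w ^+ 2 = k by rewrite sqr_sqrtr// ltW.
have w0 : 0 <= w by exact: sqrtr_ge0.
have kw : k <= w.
  by rewrite -w2 expr2 ler_piMr// -sqrtr1 ler_wsqrtr.
have e1 : rt * (rt * C1) <= rt * (w * C1).
  by rewrite ler_pM2l// ler_wpM2r.
have e2 : rt * (k * C2) <= rt * (w * C2).
  by rewrite ler_pM2l// ler_wpM2r.
have e3 : rt * (w * (C1 + C2)) <= rt * (d / 2) by rewrite ler_pM2l.
have e4 : 2 * (K * (2 * c * t * (X0 + 1 + 2 * c))) +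
    2 * (K * (rt * cp * ((1 + 2 * c) * k))) +
    K * (rt * (cp + 2 * c) * (rt * (cp + 2 * c))) = rt * (rt * C1) + rt * (k * C2).
  by rewrite /C1 /C2 -rt2; ring.
rewrite -/K in b1 b2 b3; rewrite -/rt.
lra.
Qed.

(** * Compactness of the sphere and the limit of the difference quotient *)

Section Compactness.
Import numFieldNormedType.Exports.

Lemma continuous_sumr (R : realType) (T : topologicalType) N (f : 'I_N -> T -> R) :
  (forall i, continuous (f i)) -> continuous (fun x => \sum_i f i x).
Proof.
move=> fc; rewrite /index_enum; elim: (Finite.enum _) => [|i l IH].
  by under eq_fun do rewrite big_nil; exact: cst_continuous.
under eq_fun do rewrite big_cons; move=> x.
exact: (continuousD (fc i x) (IH x)).
Qed.

Lemma continuous_mulr (R : realType) (T : topologicalType) (f g : T -> R) :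
  continuous f -> continuous g -> continuous (fun x => f x * g x).
Proof. by move=> fc gc x; exact: (continuousM (fc x) (gc x)). Qed.

Lemma continuous_coordM (R : realType) N (a : 'I_N -> R) :
  continuous (fun x : 'rV[R]_N => \sum_j x 0 j * a j).
Proof.
apply: continuous_sumr => j.
apply: continuous_mulr; last by move=> ?; exact: cst_continuous.
exact: coord_continuous.
Qed.

Lemma continuous_mulmx_coord (R : realType) N m (A : 'M[R]_(N, m)) i :
  continuous (fun x : 'rV[R]_N => (x *m A) 0 i).
Proof.
rewrite [X in continuous X](_ : _ = (fun x : 'rV[R]_N => \sum_j x 0 j * A j i)).
  exact: continuous_coordM.
by apply/funext => x; rewrite mxE.
Qed.

Lemma continuous_sqmx_coord (R : realType) N m (A : 'M[R]_(N, m)) i :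
  continuous (fun x : 'rV[R]_N => (sqmx x *m A) 0 i).
Proof.
rewrite [X in continuous X](_ : _ =
  (fun x : 'rV[R]_N => \sum_j (x 0 j * x 0 j) * A j i)).
  apply: continuous_sumr => j; apply: continuous_mulr; last by move=> ?; exact: cst_continuous.
  by apply: continuous_mulr; exact: coord_continuous.
by apply/funext => x; rewrite mxE; apply: eq_bigr => j _; rewrite mxE expr2.
Qed.

Lemma continuous_bform (R : realType) N (M : 'M[R]_N) :
  continuous (fun x => bform M x x).
Proof.
rewrite [X in continuous X](_ : _ =
  (fun x : 'rV[R]_N => \sum_j (x *m M) 0 j * x 0 j)).
  apply: continuous_sumr => j.
  by apply: continuous_mulr; [exact: continuous_mulmx_coord|exact: coord_continuous].
by apply/funext => x; rewrite bformE.
Qed.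

Lemma continuous_gradsum (R : realType) N (M : 'M[R]_N) h :
  continuous (gradsum M h).
Proof.
rewrite [X in continuous X](_ : _ =
  (fun x => \sum_j ((x *m M) 0 j * (x *m M) 0 j) / h j 0)).
  apply: continuous_sumr => j; apply: continuous_mulr; last by move=> ?; exact: cst_continuous.
  by apply: continuous_mulr; exact: continuous_mulmx_coord.
by apply/funext => x; apply: eq_bigr => j _; rewrite expr2.
Qed.

Lemma closed_densities (R : realType) N m (A : 'M[R]_(N, m)) (r : 'rV[R]_m) :
  closed [set x : 'rV[R]_N | sqmx x *m A = r].
Proof.
rewrite [X in closed X](_ : _ = \bigcap_i
  ((fun x : 'rV[R]_N => (sqmx x *m A) 0 i) @^-1` [set z | z = r 0 i])).
  apply: closed_bigI => i _; apply: preimage_closed; last exact: closed_eq.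
  by move=> x _; exact: continuous_sqmx_coord.
apply/seteqP; split => x /= H; first by move=> i _ /=; rewrite H.
by apply/rowP => i; exact: (H i).
Qed.

Lemma compact_sphere (R : realType) N (c : R) :
  compact [set x : 'rV[R]_N | \sum_j x 0 j ^+ 2 = c].
Proof.
apply: bounded_closed_compact.
  exists (Num.sqrt c); split; first exact: num_real.
  move=> z cz x /= xc; apply: le_trans (ltW cz).
  rewrite [leLHS]/Num.norm/= mx_normrE; apply: bigmax_le; first exact: sqrtr_ge0.
  move=> [i j] _ /=; rewrite ord1 -sqrtr_sqr ler_wsqrtr// -xc (bigD1 j)//= lerDl.
  by rewrite sumr_ge0// => l _; rewrite sqr_ge0.
rewrite [X in closed X](_ : _ = 
  [set x : 'rV[R]_N | sqmx x *m (const_mx 1 : 'cV[R]_N) = const_mx c]).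
  exact: closed_densities.
apply/seteqP; split => x /=.
  move=> <-; apply/rowP => i; rewrite !mxE; apply: eq_bigr => j _.
  by rewrite !mxE mulr1.
move=> /matrixP/(_ 0 0); rewrite !mxE => <-; apply: eq_bigr => j _.
by rewrite !mxE mulr1.
Qed.

Lemma near_coord (R : realType) N (x0 : 'rV[R]_N) (k : R) : 0 < k ->
  \forall x \near x0, forall j, `|(x : 'rV[R]_N) 0 j - x0 0 j| < k.
Proof.
move=> k0; near=> x => j; rewrite distrC.
have : ball x0 k x by near: x; exact: nbhsx_ballx.
by case=> _; exact.
Unshelve. all: by end_near. Qed.

(** Combines a neighbourhood of the point with a condition on the parameter into the product form
    that the covering criterion for compact sets requires. *)
Lemma near_prod (R : realType) (X : topologicalType) (F : set_system R)
    (x0 : X) (P : X -> Prop) (Q : R -> Prop) (S : R -> X -> Prop) :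
  (\forall x \near x0, P x) -> (\forall t \near F, Q t) ->
  (forall t x, P x -> Q t -> S t x) -> \forall x \near x0 & t \near F, S t x.
Proof. by move=> HP HQ PQ; exists (P, Q) => // -[x t] [/= Px Qt]; exact: PQ. Qed.

(** The pure functional in real coordinates. With homogeneous densities, normalization is part of
    the equation for [r]. *)
Definition pureF (R : realType) N D (M : 'M[R]_N) (B : 'M[R]_(N, D))
    (r : 'rV[R]_D) : R :=
  inf [set bform M x x | x in [set x | sqmx x *m B = r]].

Lemma sqmx_mass (R : realType) N D (B : 'M[R]_(N, D)) (o : 'cV[R]_D) (x : 'rV[R]_N) r :
  B *m o = const_mx 1 -> sqmx x *m B = r -> \sum_j x 0 j ^+ 2 = (r *m o) 0 0.
Proof.
move=> Bo <-; rewrite -mulmxA Bo [RHS]mxE; apply: eq_bigr => j _.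
by rewrite !mxE mulr1.
Qed.

(** The infimum lies below each value only if the energies are bounded below; the total mass, fixed
    by [r], bounds every coordinate and hence the energy. *)
Lemma pureF_le (R : realType) N D (M : 'M[R]_N) (B : 'M[R]_(N, D)) (o : 'cV[R]_D) x r :
  B *m o = const_mx 1 -> sqmx x *m B = r -> pureF M B r <= bform M x x.
Proof.
move=> Bo xr; apply: ge_inf; last by exists x.
exists (- ((\sum_i \sum_j `|M i j|) * (Num.sqrt ((r *m o) 0 0) * Num.sqrt ((r *m o) 0 0)))).
have H (y : 'rV[R]_N) j : sqmx y *m B = r -> `|y 0 j| <= Num.sqrt ((r *m o) 0 0).
  move=> yr; rewrite -sqrtr_sqr ler_wsqrtr// -(sqmx_mass Bo yr).
  by rewrite (bigD1 j)//= lerDl sumr_ge0// => l _; rewrite sqr_ge0.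
by move=> _ [y /= yr <-]; apply: lerNnormlW; apply: bform_le => j; exact: H.
Qed.

(** The local lower estimates are glued by compactness of the sphere and meet the upper estimate
    taken at the minimizer with the largest [gradsum]. *)
Theorem pureF_facet (R : realType) N D (M : 'M[R]_N) (B : 'M[R]_(N, D)) o s r e :
  facet_data B o s r e -> M^T = M -> (exists x, sqmx x *m B = r) ->
  exists x, [/\ sqmx x *m B = r, bform M x x = pureF M B r,
    forall y, sqmx y *m B = r -> bform M y y = pureF M B r ->
      gradsum M (B *m s) y <= gradsum M (B *m s) x &
    (fun t => (pureF M B (r + t *: e) - pureF M B r) / Num.sqrt t) @ 0^'+ -->
      - 2 * Num.sqrt (gradsum M (B *m s) x)].
Proof.
move=> fd MT [xf xfr].
have Bo := fd_mass fd.
set A := [set x | sqmx x *m B = r].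
have cA : compact A.
  apply: subclosed_compact (@compact_sphere R N ((r *m o) 0 0)) _.
    exact: closed_densities.
  by move=> x /= xr; exact: sqmx_mass Bo xr.
have [||x1 /set_mem/= x1r x1min] := @EVT_min_rV R _ (fun x => bform M x x) A _ cA.
- by exists xf.
- by apply: continuous_subspaceT; exact: continuous_bform.
have F1 : pureF M B r = bform M x1 x1.
  apply/eqP; rewrite eq_le (pureF_le _ Bo x1r)/=; apply: lb_le_inf.
    by exists (bform M x1 x1), x1.
  by move=> _ [y /= yr <-]; apply: x1min; exact: mem_set.
(* The minimizers form a compact set, so [gradsum] attains its maximum there; this settles the
   choice among several minimizers. *)
set A1 := A `&` [set x | bform M x x = pureF M B r].
have cA1 : compact A1.
  apply: compact_closedI => //.
  apply: (@preimage_closed _ _ (fun x => bform M x x) [set z | z = pureF M B r]).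
    by move=> x _; exact: continuous_bform.
  exact: closed_eq.
have [||x /set_mem/= [xr xF] xmax] := @EVT_max_rV R _ (gradsum M (B *m s)) A1 _ cA1.
- by exists x1.
- by apply: continuous_subspaceT; exact: continuous_gradsum.
have min_le y : sqmx y *m B = r -> pureF M B r <= bform M y y.
  exact: pureF_le Bo.
have gmax y : sqmx y *m B = r -> bform M y y = pureF M B r ->
    gradsum M (B *m s) y <= gradsum M (B *m s) x.
  by move=> yr yF; apply: xmax; apply: mem_set.
exists x; split => //.
set G := gradsum M (B *m s) x.
have ro t : (r + t *: e) *m o = r *m o.
  by rewrite mulmxDl -scalemxAl (fd_dir_mass fd) scaler0 addr0.
(* One bound for all states on the sphere at once. Near a minimizer it is [lower_bound_near]; near
   other states of density [r] the energy exceeds the minimum; near the remaining states the density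
   differs from [r + t *: e] for small [t]. *)
have lower d : 0 < d -> \forall t \near 0^'+,
    [set y : 'rV[R]_N | \sum_j y 0 j ^+ 2 = (r *m o) 0 0] `<=`
    [set y : 'rV[R]_N | sqmx y *m B = r + t *: e ->
       pureF M B r - Num.sqrt t * (2 * Num.sqrt G + d) <= bform M y y].
  move=> d0; have /compact_near_coveringP := @compact_sphere R N ((r *m o) 0 0).
  apply => y _ /=.
  have near0 k : 0 < k -> \forall t \near (0 : R)^'+, 0 < t /\ t < k.
    move=> k0; near=> t; split; near: t; first exact: nbhs_right_gt.
    exact: nbhs_right_lt.
  have Gd0 : 0 <= 2 * Num.sqrt G + d by rewrite addr_ge0 ?mulr_ge0 ?sqrtr_ge0// ltW.
  have [yr|/eqP yr] := pselect (sqmx y *m B = r).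
    have [yF|yF] := eqVneq (bform M y y) (pureF M B r).
      have ymin z : sqmx z *m B = r -> bform M y y <= bform M z z.
        by rewrite yF; exact: min_le.
      have [k k0 kP] := lower_bound_near fd MT yr ymin d0.
      apply: near_prod (near_coord y k0) (near0 _ k0) _ => t z zy [t0 tk] zB.
      apply: le_trans (kP t z t0 tk zy zB); rewrite yF lerD2l lerN2.
      by rewrite ler_wpM2l ?sqrtr_ge0// lerD2r ler_pM2l// ler_wsqrtr// gmax.
    have {}yF : pureF M B r < bform M y y.
      by rewrite lt_neqAle eq_sym yF min_le.
    have nz : \forall z \near y, pureF M B r < bform M z z.
      exact: (cvgr_gt (bform M y y) (@continuous_bform _ _ M y) _ yF).
    apply: near_prod nz (near0 _ ltr01) _ => t z zy _ _.
    by apply: le_trans (ltW zy); rewrite lerBlDr lerDl mulr_ge0 ?sqrtr_ge0.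
  have [i yi] : exists i, (sqmx y *m B) 0 i != r 0 i.
    apply: contrapT => /forallNP H; move/eqP: yr; apply; apply/rowP => i.
    by move: (H i) => /negP; rewrite negbK => /eqP.
  pose g := `|(sqmx y *m B) 0 i - r 0 i|.
  have g0 : 0 < g by rewrite normr_gt0 subr_eq0.
  have g2 : 0 < g / 2 by rewrite divr_gt0.
  have nz : \forall z \near y, `|(sqmx y *m B) 0 i - (sqmx z *m B) 0 i| < g / 2.
    by have /cvgrPdist_lt := @continuous_sqmx_coord _ _ _ B i y; exact.
  have k0 : 0 < g / 2 / (`|e 0 i| + 1) by rewrite divr_gt0// ltr_wpDl.
  apply: near_prod nz (near0 _ k0) _ => t z zy [t0].
  rewrite ltr_pdivlMr ?ltr_wpDl// => tk zB; exfalso.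
  move: zy; rewrite zB ltNge => /negP; apply.
  have -> : (sqmx y *m B) 0 i - (r + t *: e) 0 i =
     ((sqmx y *m B) 0 i - r 0 i) - t * e 0 i.
    by rewrite [(r + _) 0 i]mxE [(t *: e) 0 i]mxE; ring.
  apply: le_trans (lerB_dist _ _); rewrite -/g normrM gtr0_norm//.
  have : t * `|e 0 i| <= t * (`|e 0 i| + 1) by rewrite ler_pM2l// lerDl.
  lra.
have [C [t0 [C0 t00 upper]]] := upper_bound fd MT xr.
apply/cvgrPdist_le => d d0.
have C1 : 0 < C + 1 by rewrite ltr_wpDl.
have dC : 0 < d / (C + 1) by rewrite divr_gt0.
near=> t.
have tp : 0 < t by near: t; exact: nbhs_right_gt.
have rp : 0 < Num.sqrt t by rewrite sqrtr_gt0.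
have r2 : Num.sqrt t ^+ 2 = t by rewrite sqr_sqrtr// ltW.
have tt0 : t < t0 by near: t; exact: nbhs_right_lt.
have td : Num.sqrt t * (C + 1) <= d.
  rewrite -ler_pdivlMr// -(gtr0_norm dC) -sqrtr_sqr ler_wsqrtr//; near: t; apply: nbhs_right_ltW.
  exact: exprn_gt0.
have [y yB yle] := upper t tp tt0.
have low : pureF M B r - Num.sqrt t * (2 * Num.sqrt G + d) <= pureF M B (r + t *: e).
  apply: lb_le_inf; first by exists (bform M y y), y.
  move=> _ [z /= zB <-].
  have H : [set y : 'rV[R]_N | \sum_j y 0 j ^+ 2 = (r *m o) 0 0] `<=`
    [set y : 'rV[R]_N | sqmx y *m B = r + t *: e ->
       pureF M B r - Num.sqrt t * (2 * Num.sqrt G + d) <= bform M y y].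
    by near: t; exact: lower.
  by apply: H => //=; rewrite (sqmx_mass Bo zB) ro.
have up := le_trans (pureF_le M Bo yB) yle.
rewrite xF -/G in up.
set q := _ / _.
have qE : pureF M B (r + t *: e) = pureF M B r + q * Num.sqrt t.
  by rewrite /q divfK ?gt_eqF// [RHS]addrC subrK.
rewrite ler_norml; apply/andP; split.
  rewrite -(ler_pM2r rp).
  have : Num.sqrt t * (Num.sqrt t * (C + 1)) <= Num.sqrt t * d by rewrite ler_pM2l.
  rewrite mulrA -expr2 r2; move: up; rewrite qE; lra.
rewrite -(ler_pM2r rp).
by move: low; rewrite qE; lra.
Unshelve. all: by end_near. Qed.
End Compactness.

(** * Convex geometry of a facet *)

(** Homogeneous coordinates turn affine hulls into row spaces and make the sum of the coefficients a
    linear function of the point. *)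
Definition hom (R : realType) d (x : 'rV[R]_d) : 'rV[R]_(1 + d) := row_mx 1%:M x.

Definition hommx (R : realType) d N (w : 'I_N -> 'rV[R]_d) : 'M[R]_(N, 1 + d) :=
  \matrix_j hom (w j).

Definition affine_form (R : realType) d (a : R) (v : 'cV[R]_d) : 'cV[R]_(1 + d) :=
  col_mx a%:M v.

Lemma rank_diag_mx_le (R : realType) N (x : 'rV[R]_N) :
  (\rank (diag_mx x) <= #|[pred j | x 0%R j != 0%R]|)%N.
Proof.
rewrite diag_mx_sum_delta -sum1_card [leqRHS]big_mkcond/=.
elim/big_ind2 : _ => [|A a B b Aa Bb|j _]; first by rewrite mxrank0.
  by apply: leq_trans (mxrank_add _ _) _; rewrite leq_add.
rewrite inE; have [->|_] := eqVneq (x 0 j) 0; first by rewrite scale0r mxrank0.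
by apply: leq_trans (mxrank_scale _ _) _; rewrite mxrank_delta.
Qed.

(* If the support is too large, a kernel vector [mu] of the weighted rows does
   not vanish on it, and moving from [l] to [l_j (1 - mu_j / max mu)] keeps
   [l *m B] while emptying at least one entry. *)
Lemma caratheodory (R : realType) N D (B : 'M[R]_(N, D)) (l : 'rV[R]_N) :
  (forall j, 0 <= l 0 j) ->
  exists l' : 'rV[R]_N, [/\ forall j, 0 <= l' 0 j, l' *m B = l *m B,
    forall j, l' 0 j != 0 -> l 0 j != 0 &
    (#|[pred j | l' 0%R j != 0%R]| <= \rank (diag_mx l *m B))%N].
Proof.
have [n] := ubnP #|[pred j | l 0 j != 0]|; elim: n l => // n IH l.
rewrite ltnS => ln l0.
have [small|big] := leqP #|[pred j | l 0 j != 0%R]| (\rank (diag_mx l *m B)).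
  by exists l.
pose z : 'rV[R]_N := \row_j (l 0 j == 0)%:R.
(* The row space of [diag_mx z] consists of the vectors supported on the zeros of [l]. The kernel
   has dimension [N] minus the rank, which exceeds the number of those zeros. *)
have kz : ~~ (kermx (diag_mx l *m B) <= diag_mx z)%MS.
  apply/negP => /mxrankS; rewrite mxrank_ker leqNgt => /negP; apply.
  apply: (leq_ltn_trans (rank_diag_mx_le z)).
  have := cardC [pred j | l 0 j != 0]; rewrite card_ord => cC.
  rewrite ltn_subRL -[ltnRHS]cC -addSn leq_add//; apply: subset_leq_card.
  by apply/fintype.subsetP => j; rewrite !inE mxE negbK; case: (l 0 j == 0); rewrite ?eqxx.
case/row_subPn: kz => i; set mu := row i _ => muz.
have muB : mu *m (diag_mx l *m B) = 0 by rewrite -row_mul mulmx_ker row0.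
clearbody mu.
have [nu [nuB [j0 lj0 nuj0]]] : exists nu : 'rV[R]_N, nu *m (diag_mx l *m B) = 0 /\
    exists2 j, l 0 j != 0 & 0 < nu 0 j.
  have [j [lj muj]] : exists j, l 0 j != 0 /\ mu 0 j != 0.
    apply: contrapT => /forallNP H; move/negP: muz; apply.
    apply/submxP; exists mu; apply/rowP => j; rewrite mul_mx_diag !mxE.
    case: eqP => [_|/eqP lj]; first by rewrite mulr1.
    rewrite mulr0; apply: contrapT => muj; apply: (H j); split => //.
    exact/eqP.
  have [mujp|mujn] := ltP 0 (mu 0 j); first by exists mu; split => //; exists j.
  exists (- mu); rewrite mulNmx muB oppr0; split => //; exists j => //.
  by rewrite [(- mu) _ _]mxE oppr_gt0 lt_neqAle muj.
have := @arg_maxP _ _ _ j0 (fun j => l 0 j != 0) (fun j => nu 0 j) lj0.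
set jm := (X in extremum_spec _ _ _ X) => -[jm' ljm jmax].
set m := nu 0 jm' in jmax *; have m0 : 0 < m by exact: lt_le_trans (jmax _ lj0).
pose q : 'rV[R]_N := \row_j (1 - nu 0 j / m).
pose l1 := q *m diag_mx l.
have l1E j : l1 0 j = (1 - nu 0 j / m) * l 0 j by rewrite /l1 mul_mx_diag !mxE.
have l10 j : 0 <= l1 0 j.
  rewrite l1E; have [->|lj] := eqVneq (l 0 j) 0; first by rewrite mulr0.
  by rewrite mulr_ge0// subr_ge0 ler_pdivrMr// mul1r; exact: jmax.
have l1B : l1 *m B = l *m B.
  rewrite /l1 -mulmxA; have -> : q = const_mx 1 - m^-1 *: nu.
    by apply/rowP => j; rewrite !mxE mulrC.
  rewrite mulmxBl -scalemxAl nuB scaler0 subr0 mulmxA; congr (_ *m _).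
  by apply/rowP => j; rewrite mul_mx_diag !mxE mul1r.
have l1s j : l1 0 j != 0 -> l 0 j != 0.
  by rewrite l1E mulf_eq0 negb_or => /andP[].
have [||l' [l'0 l'B l's l'r]] := IH l1.
- apply: leq_trans ln; apply: proper_card; apply/fintype.properP; split.
    by apply/fintype.subsetP => j; rewrite !inE => /l1s.
  exists jm'; first by rewrite inE.
  have l1m : l1 0 jm' = 0 by rewrite l1E divff ?gt_eqF// subrr mul0r.
  by rewrite !inE l1m eqxx.
- exact: l10.
exists l'; split => //; first by rewrite l'B.
  by move=> j /l's /l1s.
apply: leq_trans l'r _; rewrite (_ : diag_mx l1 = diag_mx q *m diag_mx l).
  by rewrite -mulmxA mxrankM_maxr.
by rewrite mulmx_diag; congr diag_mx; apply/rowP => j; rewrite l1E !mxE.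
Qed.

(** Links dimension by free families to matrix rank: a maximal independent set of rows of [A] is a
    free sequence in [U]. *)
Lemma subspace_dim_rank (R : realType) d (U : set 'rV[R]_d) k m (A : 'M[R]_(m, d)) :
  subspace_dim U k -> (forall i, U (row i A)) -> (\rank A <= k)%N.
Proof.
move=> [_ Uk] UA; pose f := maxrankfun A.
pose t := [tuple row (f i) A | i < \rank A].
have fr : free t.
  apply/freeP => c c0 i.
  suff /rowP/(_ i) : \row_i c i = 0 :> 'rV[R]_(\rank A) by rewrite !mxE.
  apply: (row_free_inj (maxrowsub_free A)); rewrite /= mul0mx mulmx_sum_row -[RHS]c0.
  by apply: eq_bigr => j _; rewrite mxE row_rowsub -tnth_nth tnth_mktuple.
rewrite -(size_tuple t); apply: Uk => //.
by move=> x /mapP[i _ ->]; exact: UA.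
Qed.

Lemma subspace_dim_uniq (R : realType) d (U : set 'rV[R]_d) k l :
  subspace_dim U k -> subspace_dim U l -> k = l.
Proof.
move=> [[s [sU fs <-]] Uk] [[t [tU ft <-]] Ul].
by apply/eqP; rewrite eqn_leq Ul// Uk.
Qed.

Lemma affh_id (R : realType) d (X : set 'rV[R]_d) x : X x -> affh X x.
Proof.
move=> Xx; exists 1, (fun=> x), (fun=> 1); split => //; rewrite big_ord1//.
by rewrite scale1r.
Qed.

(** Relative to one base point the selected rows differ by vectors of the translation space, of rank
    at most [k], and the base point adds one. Rows outside [A] are set to zero so that the index
    type stays the same. *)
Lemma rank_hommx_le (R : realType) d N (w : 'I_N -> 'rV[R]_d) (X : set 'rV[R]_d) k
    (A : pred 'I_N) : affdim X k -> (forall j, A j -> X (w j)) ->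
  (\rank (\matrix_j (if A j then hom (w j) else 0%R)) <= k.+1)%N.
Proof.
move=> Xk Xw; have [i0 Ai0|A0] := pickP A; last first.
  rewrite [X in \rank X](_ : _ = 0) ?mxrank0//.
  by apply/row_matrixP => j; rewrite rowK A0 row0.
pose Dm := \matrix_j (if A j then w j - w i0 else 0) : 'M[R]_(N, d).
have Dk : (\rank Dm <= k)%N.
  apply: subspace_dim_rank Xk _ => j; rewrite rowK.
  have Xi0 : affh X (w i0) by apply: affh_id; exact: Xw.
  case: ifPn => [Aj|_]; last by exists (w i0) => //; exists (w i0); rewrite ?subrr.
  by exists (w j); [apply: affh_id; exact: Xw|exists (w i0)].
have sub : (\matrix_j (if A j then hom (w j) else 0%R) <=
    hom (w i0) + row_mx (0%R : 'M[R]_(N, 1)) Dm)%MS.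
  apply/row_subP => j; rewrite rowK; case: ifPn => [Aj|_]; last exact: sub0mx.
  have -> : hom (w j) = hom (w i0) + row j (row_mx (0 : 'M[R]_(N, 1)) Dm).
    rewrite row_row_mx rowK Aj /hom add_row_mx row0 addr0.
    by rewrite addrC subrK.
  by rewrite addmx_sub_adds// row_sub.
apply: leq_trans (mxrankS sub) _; apply: leq_trans (mxrank_adds_leqif _ _) _.
apply: (@leq_add _ _ 1 k); first exact: rank_leq_row.
have -> : row_mx (0 : 'M[R]_(N, 1)) Dm = Dm *m row_mx 0 1%:M.
  by rewrite mul_mx_row mulmx0 mulmx1.
exact: leq_trans (mxrankM_maxl _ _) Dk.
Qed.

Lemma hom_affine_form (R : realType) d (x : 'rV[R]_d) a v :
  (hom x *m affine_form a v) 0 0 = a + vpair x v.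
Proof. by rewrite /hom /affine_form mul_row_col mul1mx mxE [X in X + _]mxE eqxx mulr1n. Qed.

Lemma hom_sum (R : realType) d k (l : 'I_k -> R) (p : 'I_k -> 'rV[R]_d) :
  \sum_i l i = 1 -> hom (\sum_i l i *: p i) = \sum_i l i *: hom (p i).
Proof.
move=> l1; have -> : \sum_i l i *: hom (p i) =
    row_mx (\sum_i l i *: 1%:M) (\sum_i l i *: p i).
  rewrite /hom; elim/big_rec3 : _ => [|i x y z _ ->]; first by rewrite row_mx0.
  by rewrite scale_row_mx add_row_mx.
by rewrite -scaler_suml l1 scale1r.
Qed.

Lemma affh_hommx (R : realType) d N (w : 'I_N -> 'rV[R]_d) x :
  affh (range w) x -> (hom x <= hommx w)%MS.
Proof.
move=> [k [p [l [pw l1 ->]]]]; rewrite hom_sum//; apply: summx_sub => i _.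
apply: scalemx_sub; have [j _ <-] := pw i.
by rewrite -(rowK (fun j => hom (w j))) row_sub.
Qed.

(** Every density in the polytope comes from a state: coefficients of points assigned to the same
    index are added, and the coordinates are the square roots of these sums. *)
Lemma convh_hommx (R : realType) d N (w : 'I_N -> 'rV[R]_d) x :
  convh (range w) x -> exists y, sqmx y *m hommx w = hom x.
Proof.
move=> [k [p [l [pw l0 l1 ->]]]]; rewrite hom_sum//.
have /fin_all_exists[f fp] : forall i, exists j, w j = p i.
  by move=> i; have [j _ <-] := pw i; exists j.
exists (\row_j Num.sqrt (\sum_(i | f i == j) l i)).
rewrite mulmx_sum_row (partition_big f predT)//=; apply: eq_bigr => j _.
rewrite rowK !mxE sqr_sqrtr ?sumr_ge0// scaler_suml; apply: eq_bigr => i /eqP <-.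
by rewrite fp.
Qed.

Lemma hommx_affine_form (R : realType) d N (w : 'I_N -> 'rV[R]_d) a v j :
  (hommx w *m affine_form a v) j 0 = a + vpair (w j) v.
Proof.
have -> : (hommx w *m affine_form a v) j 0 =
    (row j (hommx w *m affine_form a v)) 0 0 by rewrite [RHS]mxE.
by rewrite row_mul rowK hom_affine_form.
Qed.

Lemma convh_id (R : realType) d (X : set 'rV[R]_d) x : X x -> convh X x.
Proof.
move=> Xx; exists 1, (fun=> x), (fun=> 1); split => //; rewrite big_ord1//.
by rewrite scale1r.
Qed.

Lemma vpairD (R : realType) d (x y : 'rV[R]_d) v :
  vpair (x + y) v = vpair x v + vpair y v.
Proof. by rewrite /vpair mulmxDl mxE. Qed.

Lemma vpairB (R : realType) d (x y : 'rV[R]_d) v :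
  vpair (x - y) v = vpair x v - vpair y v.
Proof. by rewrite /vpair mulmxBl mxE [X in _ + X]mxE. Qed.

Lemma vpairZ (R : realType) d a (x : 'rV[R]_d) v : vpair (a *: x) v = a * vpair x v.
Proof. by rewrite /vpair -scalemxAl mxE. Qed.

(** If the rank were at most [k], Caratheodory's theorem applied to the masses of [x] would write
    [rho] as a convex combination of at most [k] weights on the facet, against genericity. *)
Lemma generic_rank (R : realType) d N (w : 'I_N -> 'rV[R]_d) (F : set 'rV[R]_d) k rho x :
  (forall s : seq 'rV[R]_d, size s = k ->
     {in s, forall v, (range w `&` F) v} -> ~ conv_seq s rho) ->
  sqmx x *m hommx w = hom rho -> (forall j, x 0 j != 0 -> F (w j)) ->
  (k < \rank (diag_mx x *m hommx w))%N.
Proof.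
move=> gen xB xF; rewrite ltnNge; apply/negP => rk.
have sq0 j : 0 <= sqmx x 0 j by rewrite mxE sqr_ge0.
have [l [l0 lB lx lr]] := caratheodory (hommx w) sq0.
have {lr} lr : (#|[pred j | l 0%R j != 0%R]| <= k)%N.
  apply: leq_trans lr (leq_trans _ rk).
  have -> : diag_mx (sqmx x) = diag_mx x *m diag_mx x.
    by rewrite mulmx_diag; congr diag_mx; apply/rowP => j; rewrite !mxE expr2.
  by rewrite -mulmxA mxrankM_maxr.
have lF j : l 0 j != 0 -> F (w j).
  by move=> /lx; rewrite mxE sqrf_eq0; exact: xF.
have : \sum_j l 0 j *: hom (w j) = hom rho.
  rewrite -xB -lB mulmx_sum_row; apply: eq_bigr => j _.
  by rewrite -(rowK (fun j => hom (w j))).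
move=> lh.
have l1 : \sum_j l 0 j = 1.
  have := congr1 (fun y => (y *m affine_form 1 0) 0 0) lh.
  rewrite hom_affine_form /vpair mulmx0 [X in _ = 1 + X]mxE addr0 mulmx_suml summxE => <-.
  apply: eq_bigr => j _; rewrite -scalemxAl mxE hom_affine_form /vpair mulmx0.
  by rewrite [X in 1 + X]mxE addr0 mulr1.
have lrho : \sum_j l 0 j *: w j = rho.
  by move: lh; rewrite -hom_sum// => /eq_row_mx[].
have [j0 lj0] : exists j, l 0 j != 0.
  apply: contrapT => /forallNP H; move: l1; rewrite big1 => [/eqP|j _].
    by rewrite eq_sym oner_eq0.
  by apply/eqP; move: (H j) => /negP; rewrite negbK.
pose t := [seq w j | j <- enum [pred j | l 0%R j != 0%R]].
(* Genericity speaks of lists of length exactly [k], so the list is padded with copies of a weight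
   already in it. *)
pose s := t ++ nseq (k - size t) (w j0).
have tk : (size t <= k)%N by rewrite size_map -cardE.
have wt j : l 0 j != 0 -> w j \in t.
  by move=> lj; apply/map_f; rewrite mem_enum inE.
apply: (gen s); first by rewrite size_cat size_nseq subnKC.
  move=> v; rewrite mem_cat => /orP[/mapP[j] |].
    by rewrite mem_enum inE => lj ->; split; [exists j|exact: lF].
  by rewrite mem_nseq => /andP[_ /eqP ->]; split; [exists j0|exact: lF].
exists N, (fun j => if l 0 j == 0 then w j0 else w j), (fun j => l 0 j); split => //.
  by move=> j /=; case: ifPn => [_|lj]; rewrite mem_cat wt.
rewrite -lrho; apply: eq_bigr => j _; case: eqP => [->|//]; by rewrite !scale0r.
Qed.

(** A rank count drives the proof: the rows on the facet already span, up to the single direction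
    [e], the row space of [B]. Affine functions constant on the facet are therefore compared through
    their values on [e] alone. *)
Lemma facet_dataP (R : realType) d N (w : 'I_N -> 'rV[R]_d) (F : set 'rV[R]_d) k
    (rho eta gamma : 'rV[R]_d) (S : 'cV[R]_d) :
  facet (convh (range w)) F -> affdim F k -> F rho ->
  (forall s : seq 'rV[R]_d, size s = k ->
     {in s, forall v, (range w `&` F) v} -> ~ conv_seq s rho) ->
  trans_space (affh (range w)) eta ->
  (exists2 e0 : R, 0 < e0 &
     forall e : R, 0 <= e <= e0 -> convh (range w) (rho + e *: eta)) ->
  (forall alpha, trans_space (affh F) alpha -> vpair alpha S = 0) ->
  vpair eta S = 1 -> affh F gamma ->
  facet_data (hommx w) (affine_form 1 0) (affine_form (- vpair gamma S) S)
    (hom rho) (row_mx 0 eta) /\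
  forall j, F (w j) <-> (hommx w *m affine_form (- vpair gamma S) S) j 0 = 0.
Proof.
move=> [[n [c [Pn FE]]] _ [k' [Fk' Pk']]] Fk Frho gen etaT [e0 e00 inw] SF etaS Fgamma.
have kk' := subspace_dim_uniq Fk Fk'; subst k'.
set B := hommx w; set s := affine_form _ S.
have Pw j : convh (range w) (w j) by apply: convh_id; exists j.
have Fw j : F (w j) <-> vpair (w j) n = c.
  by rewrite FE; split => [[]|wc]//; split.
have rhoc : vpair rho n = c by move: Frho; rewrite FE => -[].
have etan : vpair eta n <= 0.
  have := Pn _ (inw e0 _); rewrite lexx (ltW e00) => /(_ isT).
  by rewrite vpairD vpairZ rhoc gerDl pmulr_rle0.
pose A j : bool := `[< F (w j) >].
pose BA : 'M[R]_(N, 1 + d) := \matrix_j (if A j then hom (w j) else 0).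
have rowB j : row j B = hom (w j) by rewrite rowK.
have BAB : (BA <= B)%MS.
  apply/row_subP => j; rewrite rowK; case: ifP => _; last exact: sub0mx.
  by rewrite -rowB row_sub.
pose e : 'rV[R]_(1 + d) := row_mx 0 eta.
have eB : (e <= B)%MS.
  have [a aw [b bw eab]] := etaT.
  have -> : e = hom a - hom b.
    by rewrite /hom opp_row_mx add_row_mx subrr -eab.
  by rewrite addmx_sub ?eqmx_opp ?affh_hommx.
have es : e *m s = 1%:M.
  by apply/matrixP => i j; rewrite !ord1 mul_row_col mul0mx add0r -/(vpair _ _) etaS mxE.
have hS j : (B *m s) j 0 = vpair (w j) S - vpair gamma S.
  by rewrite hommx_affine_form addrC.
have FS y : affh F y -> vpair y S = vpair gamma S.
  move=> Fy; apply/eqP; rewrite -subr_eq0 -vpairB; apply/eqP; apply: SF.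
  by exists y => //; exists gamma.
have BAs : BA *m s = 0.
  apply/row_matrixP => j; rewrite row_mul rowK row0; case: ifPn => [/asboolP Fj|_].
    apply/matrixP => i l; rewrite !ord1 hom_affine_form mxE FS ?addNr//.
    exact: affh_id.
  by rewrite mul0mx.
have rhos : hom rho *m s = 0.
  apply/matrixP => i l; rewrite !ord1 hom_affine_form mxE FS ?addNr//.
  exact: affh_id.
(* The slack [c - <w_i, n>] is nonnegative and its mean over the masses of [x] is the slack of
   [rho], which is 0. *)
have onF x : sqmx x *m B = hom rho -> forall j, x 0 j != 0 -> F (w j).
  move=> xB j xj; apply/Fw; pose g i := (B *m affine_form c (- n)) i 0.
  have gE i : g i = c - vpair (w i) n.
    by rewrite /g hommx_affine_form /vpair mulmxN [X in _ + X]mxE.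
  have g0 i : 0 <= g i by rewrite gE subr_ge0 Pn.
  have : \sum_i x 0 i ^+ 2 * g i = 0.
    have : (sqmx x *m B *m affine_form c (- n)) 0 0 = 0.
      by rewrite xB hom_affine_form /vpair mulmxN [X in _ + X]mxE -/(vpair _ _) rhoc subrr.
    rewrite -mulmxA mxE => E0; rewrite -[RHS]E0; apply: eq_bigr => i _.
    by rewrite [sqmx _ _ _]mxE.
  move/psumr_eq0P => /(_ (fun i _ => mulr_ge0 (sqr_ge0 _) (g0 i)) j isT)/eqP.
  by rewrite mulf_eq0 sqrf_eq0 (negbTE xj)/= gE subr_eq0 => /eqP.
have diag_sub x : sqmx x *m B = hom rho -> (diag_mx x *m B <= BA)%MS.
  move=> xB; apply/row_subP => j; rewrite row_mul row_diag_mx -scalemxAl -rowE rowB.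
    have [->|xj] := eqVneq (x 0 j) 0; first by rewrite scale0r sub0mx.
    apply: scalemx_sub; have Aj : A j by apply/asboolP; exact: onF xj.
    have -> : hom (w j) = row j BA by rewrite rowK Aj.
    exact: row_sub.
have span x : sqmx x *m B = hom rho -> (BA <= diag_mx x *m B)%MS.
  move=> xB; have xBA := diag_sub _ xB.
  rewrite -(mxrank_leqif_sup xBA) eqn_leq mxrankS//=.
  apply: leq_trans (generic_rank gen xB (onF _ xB)).
  by apply: rank_hommx_le Fk _ => j /asboolP.
have [y yB] : exists y, sqmx y *m B = hom rho.
  by apply: convh_hommx; move: Frho; rewrite FE => -[].
(* [B] has rank at most [k + 2]. [BA] has rank at least [k + 1] by genericity, and [e] lies outside
   its row space because [BA] has height 0 while [e] has height 1. *)
have Bsub : (B <= BA + e)%MS.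
  have sB : (BA + e <= B)%MS by rewrite addsmx_sub BAB eB.
  rewrite -(mxrank_leqif_sup sB) eqn_leq mxrankS//=.
  apply: (@leq_trans k.+2).
    have := @rank_hommx_le _ _ _ w _ _ predT Pk' (fun j _ => Pw j).
    by congr (_ <= _)%N; congr mxrank; apply/row_matrixP => j; rewrite !rowK.
  apply: leq_ltn_trans (_ : \rank BA < _)%N.
    apply: leq_trans (generic_rank gen yB (onF _ yB)) _.
    by apply: mxrankS; exact: diag_sub.
  apply: rank_ltmx; rewrite ltmxE addsmxSl addsmx_sub submx_refl/=.
  apply/negP => /submxP[u eu]; move: es; rewrite -/e eu -mulmxA BAs mulmx0.
  by move/matrixP/(_ 0 0)/eqP; rewrite !mxE eq_sym oner_eq0.
have decomp m (t : 'M[R]_(m, 1 + d)) : (t <= B)%MS ->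
    exists u v, t = u *m BA + v *m e.
  by move=> /submx_trans/(_ Bsub)/sub_addsmxP[[u v] ->]; exists u, v.
(* Height and slack both vanish on [BA], so the slack of [w j] is its height times [- <eta, n>]. The
   slack is positive off the facet and the factor is nonnegative, hence the height is positive. *)
have h_pos j : ~ F (w j) -> 0 < (B *m s) j 0.
  move=> nF; have /decomp[u [v jE]] : (row j B <= B)%MS by exact: row_sub.
  have hj : (B *m s) j 0 = v 0 0.
    have -> : (B *m s) j 0 = (row j B *m s) 0 0 by rewrite -row_mul [RHS]mxE.
    by rewrite jE mulmxDl -!mulmxA BAs es mulmx0 add0r mulmx1.
  have BAn : BA *m affine_form c (- n) = 0.
    apply/row_matrixP => i; rewrite row_mul rowK row0.
    case: ifPn => [/asboolP/Fw wi|_]; last by rewrite mul0mx.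
    apply/matrixP => a b; rewrite !ord1 hom_affine_form /vpair mulmxN [X in _ + X]mxE.
    by rewrite -/(vpair _ _) wi subrr mxE.
  have : (row j B *m affine_form c (- n)) 0 0 = v 0 0 * - vpair eta n.
    rewrite jE mulmxDl -!mulmxA BAn mulmx0 add0r mul_row_col mul0mx add0r.
    by rewrite mxE big_ord1 mulmxN [X in _ * X]mxE.
  rewrite rowB hom_affine_form /vpair mulmxN [X in _ + X]mxE -!/(vpair _ _) hj => cE.
  have : 0 < v 0 0 * - vpair eta n.
    rewrite -cE subr_gt0 lt_neqAle Pn// andbT.
    by apply/eqP => /Fw.
  have : 0 <= - vpair eta n by rewrite oppr_ge0.
  rewrite le_eqVlt => /orP[/eqP <-|np]; first by rewrite mulr0 ltxx.
  by rewrite pmulr_lgt0.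
have h_F j : F (w j) <-> (B *m s) j 0 = 0.
  split => [Fj|h0]; first by rewrite hS FS ?subrr//; exact: affh_id.
  by apply: contrapT => /h_pos; rewrite h0 ltxx.
split => //; split => //.
- apply/matrixP => j i; rewrite !ord1 hommx_affine_form /vpair mulmx0.
  by rewrite [X in _ + X]mxE addr0 mxE.
- move=> j; have [/h_F->//|/h_pos/ltW//] := pselect (F (w j)).
- by rewrite mul_row_col mul0mx mulmx0 addr0.
- move=> x t xB tB ts; have [u [v tE]] := decomp _ _ tB.
  move: ts; rewrite tE mulmxDl -!mulmxA BAs es mulmx0 add0r mulmx1 => ->.
  by rewrite mul0mx addr0 mulmx_sub// span.
Qed.

(** * Diagonalization and passage to real coordinates *)

Section Spectrum.
Variable R : realType.
Local Notation C := R[i].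

Lemma adjE m p (A : 'M[C]_(m, p)) i j : adj A i j = conjc (A j i).
Proof. by rewrite !mxE. Qed.

Lemma adjK m p (A : 'M[C]_(m, p)) : adj (adj A) = A.
Proof. by apply/matrixP => i j; rewrite !adjE conjcK. Qed.

Lemma adjM m p q (A : 'M[C]_(m, p)) (B : 'M[C]_(p, q)) :
  adj (A *m B) = adj B *m adj A.
Proof. by rewrite /adj map_mxM trmx_mul. Qed.

Lemma toCE : @toC R = real_complex R. Proof. by []. Qed.

Lemma unitarymx_adj n (U : 'M[C]_n) : U \is unitarymx ->
  U *m adj U = 1%:M /\ adj U *m U = 1%:M.
Proof.
move=> Uu; have e : adj U = map_mx Num.conj U^T.
  by apply/matrixP => i j; rewrite adjE !mxE.
rewrite e; split; first exact/unitarymxP.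
by rewrite -invmx_unitary// mulVmx// unitarymx_unit.
Qed.

(* A triangular Hermitian matrix is diagonal, so simultaneous unitary
   trigonalization of the commuting family [iota v] diagonalizes it. *)
Lemma joint_spectrum d n (iota : 'cV[R]_d -> 'M[C]_n) :
  Rlinear iota -> (forall v, herm (iota v)) -> abelian_theory iota ->
  exists (U : 'M[C]_n) (w : 'I_n -> 'rV[R]_d),
    [/\ U *m adj U = 1%:M, adj U *m U = 1%:M &
    forall v, iota v = adj U *m diag_mx (\row_a toC (vpair (w a) v)) *m U].
Proof.
move=> [iD iZ] iH iA.
have [|U Uu /allP Utrig] := @cotrigonalization C n
  [seq iota (delta_mx j 0) | j <- enum 'I_d].
  by move=> _ _ /mapP[j _ ->] /mapP[l _ ->]; exact: iA.
have [UU' U'U] := unitarymx_adj Uu.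
have adj_conj : map_mx Num.conj U^T = adj U by apply/matrixP => i j; rewrite adjE !mxE.
(* Only the images of the basis vectors are diagonalized; linearity of [iota] recovers every [v]. *)
pose D j := U *m iota (delta_mx j 0) *m adj U.
have Dherm j : adj (D j) = D j.
  by rewrite /D !adjM adjK mulmxA (iH (delta_mx j 0)).
have Ddiag j a b : a != b -> D j a b = 0.
  have trig (a' b' : 'I_n) : (a' < b')%N -> D j a' b' = 0.
    have := Utrig (iota (delta_mx j 0)) (map_f _ (mem_enum _ j)).
    by rewrite /= /mxred.similar_to conjymx// adj_conj => /is_trig_mxP; exact.
  rewrite neq_ltn => /orP[|ba]; first exact: trig.
  by rewrite -Dherm adjE trig ?conjc0.
pose w (a : 'I_n) : 'rV[R]_d := \row_j complex.Re (D j a a).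
have DE j : D j = diag_mx (\row_a toC (w a 0 j)).
  apply/matrixP => a b; rewrite [RHS]mxE [(\row__ _) _ _]mxE [w _ _ _]mxE.
  have [->|ab] := eqVneq a b; last by rewrite mulr0n Ddiag.
  rewrite mulr1n; have := adjE (D j) b b; rewrite Dherm.
  case: (D j b b) => x y [] /= /eqP; rewrite -subr_eq0 opprK -mulr2n mulrn_eq0/=.
  by move/eqP ->.
exists U, w; split => // v.
have iE j : iota (delta_mx j 0) = adj U *m D j *m U.
  by rewrite /D !mulmxA U'U mul1mx -mulmxA U'U mulmx1.
have i0 : iota 0 = 0 by have := iZ 0 0; rewrite scale0r toCE rmorph0 scale0r.
have iS (f : 'I_d -> 'cV[R]_d) : iota (\sum_j f j) = \sum_j iota (f j).
  exact: (big_morph iota iD i0).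
have vE : v = \sum_j v j 0 *: delta_mx j 0.
  rewrite [LHS]matrix_sum_delta; apply: eq_bigr => j _.
  by rewrite big_ord1.
rewrite {1}vE iS; under eq_bigr do rewrite iZ iE DE.
under eq_bigr do rewrite scalemxAl scalemxAr.
rewrite -mulmx_suml -mulmx_sumr; congr (_ *m _ *m _).
apply/matrixP => a b; rewrite summxE [RHS]mxE [(\row__ _) _ _]mxE.
have [->|ab] := eqVneq a b; last first.
  by rewrite mulr0n big1// => j _; rewrite !mxE (negbTE ab) mulr0n mulr0.
rewrite mulr1n /vpair mxE toCE rmorph_sum; apply: eq_bigr => j _.
by rewrite !mxE eqxx mulr1n -!toCE toCE rmorphM mulrC.
Qed.
End Spectrum.

(** * Real coordinates of complex vectors and Hermitian forms *)

Section Realification.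
Variable R : realType.
Local Notation C := R[i].

Definition realvec n (c : 'cV[C]_n) : 'rV[R]_(n + n) :=
  row_mx (\row_a complex.Re (c a 0)) (\row_a complex.Im (c a 0)).

(** The usual real form of [W] acting on columns. For Hermitian [W] it is symmetric, so it acts in
    the same way on rows from the right. *)
Definition realmat n (W : 'M[C]_n) : 'M[R]_(n + n) :=
  block_mx (map_mx (@complex.Re R) W) (- map_mx (@complex.Im R) W)
           (map_mx (@complex.Im R) W) (map_mx (@complex.Re R) W).

(** The real and the imaginary part of a coordinate carry the same weight, so the family of weights
    is repeated. *)
Definition dup T n (w : 'I_n -> T) (j : 'I_(n + n)) : T :=
  match fintype.split j with inl a => w a | inr a => w a end.

Lemma dup_lshift T n (w : 'I_n -> T) a : dup w (lshift n a) = w a.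
Proof. by rewrite /dup (unsplitK (inl a)). Qed.

Lemma dup_rshift T n (w : 'I_n -> T) a : dup w (rshift n a) = w a.
Proof. by rewrite /dup (unsplitK (inr a)). Qed.

Lemma range_dup T n (w : 'I_n -> T) : range (dup w) = range w.
Proof.
apply/seteqP; split => x [j _ <-]; last by exists (lshift n j); rewrite ?dup_lshift.
by rewrite /dup; case: fintype.split => a; exists a.
Qed.

Lemma realvec_lshift n (c : 'cV[C]_n) a : realvec c 0 (lshift n a) = complex.Re (c a 0).
Proof. by rewrite row_mxEl mxE. Qed.

Lemma realvec_rshift n (c : 'cV[C]_n) a : realvec c 0 (rshift n a) = complex.Im (c a 0).
Proof. by rewrite row_mxEr mxE. Qed.

Lemma realvec_surj n (x : 'rV[R]_(n + n)) : exists c : 'cV[C]_n, realvec c = x.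
Proof.
exists (\col_a Complex (x 0 (lshift n a)) (x 0 (rshift n a))).
by rewrite -[RHS]hsubmxK; congr row_mx; apply/rowP => a; rewrite !mxE.
Qed.

Lemma ReD (x y : C) : complex.Re (x + y) = complex.Re x + complex.Re y.
Proof. by case: x; case: y. Qed.

Lemma ImD (x y : C) : complex.Im (x + y) = complex.Im x + complex.Im y.
Proof. by case: x; case: y. Qed.

Lemma Re_sum n (f : 'I_n -> C) : complex.Re (\sum_i f i) = \sum_i complex.Re (f i).
Proof. exact: (big_morph _ ReD erefl). Qed.

Lemma Im_sum n (f : 'I_n -> C) : complex.Im (\sum_i f i) = \sum_i complex.Im (f i).
Proof. exact: (big_morph _ ImD erefl). Qed.

Lemma Re_conjM (x y : C) :
  complex.Re (conjc x * y) = complex.Re x * complex.Re y + complex.Im x * complex.Im y.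
Proof. by case: x => a b; case: y => c d /=; rewrite mulNr opprK. Qed.

Lemma Re_inner n (c e : 'cV[C]_n) :
  complex.Re ((adj c *m e) 0 0) = \sum_j realvec c 0 j * realvec e 0 j.
Proof.
rewrite mxE Re_sum big_split_ord/= -big_split/=; apply: eq_bigr => a _.
by rewrite adjE Re_conjM !realvec_lshift !realvec_rshift.
Qed.

Lemma vnorm2E n (c : 'cV[C]_n) : vnorm2 c = \sum_j realvec c 0 j ^+ 2.
Proof. by rewrite /vnorm2 Re_inner; apply: eq_bigr => j _; rewrite expr2. Qed.

Lemma sum_dup n (c : 'cV[C]_n) (V : lmodType R) (g : 'I_n -> V) :
  \sum_j (realvec c 0 j ^+ 2) *: dup g j =
  \sum_a (complex.Re (c a 0) ^+ 2 + complex.Im (c a 0) ^+ 2) *: g a.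
Proof.
rewrite big_split_ord/= -big_split/=; apply: eq_bigr => a _.
by rewrite dup_lshift dup_rshift realvec_lshift realvec_rshift scalerDl.
Qed.

Lemma realvec_mul n (W : 'M[C]_n) (c : 'cV[C]_n) : herm W ->
  realvec (W *m c) = realvec c *m realmat W.
Proof.
move=> WH; have WE a b : complex.Re (W a b) = complex.Re (W b a) /\
    complex.Im (W a b) = - complex.Im (W b a).
  by rewrite -{1 3}WH adjE; case: (W b a).
rewrite /realvec /realmat mul_row_block; congr row_mx; apply/rowP => a.
  rewrite !mxE Re_sum -big_split/=; apply: eq_bigr => b _; rewrite !mxE.
  have [wr wi] := WE a b; move: wr wi.
  by case: (W a b) => p q; case: (c b 0) => x y /= -> ->; ring.
rewrite !mxE Im_sum -big_split/=; apply: eq_bigr => b _; rewrite !mxE.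
have [wr wi] := WE a b; move: wr wi.
by case: (W a b) => p q; case: (c b 0) => x y /= -> ->; ring.
Qed.

Lemma realmat_sym n (W : 'M[C]_n) : herm W -> (realmat W)^T = realmat W.
Proof.
move=> WH; rewrite /realmat tr_block_mx; congr block_mx; apply/matrixP => a b;
  rewrite !mxE -{1}WH adjE; case: (W _ _) => //= p q; by rewrite ?opprK.
Qed.

Lemma expectE n (W : 'M[C]_n) (c : 'cV[C]_n) : herm W ->
  expect W c = bform (realmat W) (realvec c) (realvec c).
Proof.
move=> WH; rewrite /expect -mulmxA Re_inner realvec_mul// bformE.
by apply: eq_bigr => j _; rewrite mulrC.
Qed.

Lemma conj_mul_self (x : C) :
  conjc x * x = toC (complex.Re x ^+ 2 + complex.Im x ^+ 2).
Proof. by case: x => a b; congr Complex => /=; ring. Qed.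

Lemma toC_inj : injective (@toC R).
Proof. by move=> a b []. Qed.

End Realification.

(** * Weights, densities and projections in a joint eigenbasis *)

Section Spectral.
Variables (R : realType) (d n : nat) (iota : 'cV[R]_d -> 'M[R[i]]_n).
Variables (U : 'M[R[i]]_n) (w : 'I_n -> 'rV[R]_d).
Hypotheses (UU' : U *m adj U = 1%:M) (U'U : adj U *m U = 1%:M).
Hypothesis iotaE :
  forall v, iota v = adj U *m diag_mx (\row_a toC (vpair (w a) v)) *m U.

Lemma vpair_delta (x : 'rV[R]_d) j : vpair x (delta_mx j 0) = x 0 j.
Proof.
rewrite /vpair mxE (bigD1 j)//= mxE !eqxx mulr1 big1 ?addr0// => i ij.
by rewrite mxE (negbTE ij) mulr0.
Qed.

Lemma vpair_sum m (k : 'I_m -> R) (x : 'I_m -> 'rV[R]_d) v :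
  vpair (\sum_a k a *: x a) v = \sum_a k a * vpair (x a) v.
Proof.
by rewrite /vpair mulmx_suml summxE; apply: eq_bigr => a _; rewrite -scalemxAl mxE.
Qed.

Lemma vpair_inj (x y : 'rV[R]_d) : (forall v, vpair x v = vpair y v) -> x = y.
Proof. by move=> xy; apply/rowP => j; rewrite -!vpair_delta. Qed.

Lemma weight_spaceP alpha psi :
  weight_space iota alpha psi <-> forall a, (U *m psi) a 0 != 0 -> w a = alpha.
Proof.
have mulUE v : U *m (iota v *m psi) =
    diag_mx (\row_a toC (vpair (w a) v)) *m (U *m psi).
  by rewrite iotaE -!mulmxA mulmxA UU' mul1mx.
split => [H a ca|H v].
  apply: vpair_inj => v; apply: toC_inj; have := congr1 (mulmx U) (H v).
  rewrite mulUE -scalemxAr => /matrixP/(_ a 0).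
  by rewrite mul_diag_mx [LHS]mxE [(\row__ _) _ _]mxE [RHS]mxE; exact: mulIf.
have : U *m (iota v *m psi) = U *m (toC (vpair alpha v) *: psi).
  rewrite mulUE -scalemxAr mul_diag_mx; apply/matrixP => a b; rewrite ord1 [LHS]mxE.
  rewrite [(\row__ _) _ _]mxE [RHS]mxE.
  by have [->|ca] := eqVneq ((U *m psi) a 0) 0; rewrite ?mulr0// H.
by move/(congr1 (mulmx (adj U))); rewrite !mulmxA U'U !mul1mx.
Qed.

Lemma weightsE : weights iota = range w.
Proof.
apply/seteqP; split => alpha.
  move=> [psi /weight_spaceP H psi0].
  have [a ca] : exists a, (U *m psi) a 0 != 0.
    apply: contrapT => /forallNP Ha; move/eqP: psi0; apply.
    rewrite -[psi]mul1mx -U'U -mulmxA [U *m psi](_ : _ = 0) ?mulmx0//.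
    by apply/colP => a; rewrite [RHS]mxE; apply/eqP; move: (Ha a) => /negP; rewrite negbK.
  by exists a => //; exact: H.
move=> [a _ <-]; have UE : U *m (adj U *m delta_mx a 0) = delta_mx a (0 : 'I_1).
  by rewrite mulmxA UU' mul1mx.
exists (adj U *m delta_mx a 0).
  apply/weight_spaceP => b; rewrite UE mxE eqxx andbT.
  by have [->//|_] := eqVneq b a; rewrite eqxx.
apply/eqP => /(congr1 (mulmx U)); rewrite UE mulmx0 => /matrixP/(_ a 0)/eqP.
by rewrite !mxE !eqxx oner_eq0.
Qed.

Lemma pure_densityE psi rho : pure_density iota psi rho <->
  \sum_j (realvec (U *m psi) 0 j ^+ 2) *: dup w j = rho.
Proof.
rewrite sum_dup; set c := U *m psi.
have trE v : \tr (psi *m adj psi *m iota v) =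
    toC (vpair (\sum_a (complex.Re (c a 0) ^+ 2 + complex.Im (c a 0) ^+ 2) *: w a) v).
  rewrite -mulmxA mxtrace_mulC iotaE.
  have -> : adj psi *m (adj U *m diag_mx (\row_a toC (vpair (w a) v)) *m U) *m psi =
     adj c *m diag_mx (\row_a toC (vpair (w a) v)) *m c.
    by rewrite /c adjM !mulmxA.
  rewrite mul_mx_diag /mxtrace big_ord1 mxE vpair_sum toCE rmorph_sum.
  apply: eq_bigr => a _; rewrite mxE adjE [(\row__ _) _ _]mxE.
  by rewrite [RHS]rmorphM/= -!toCE -conj_mul_self mulrAC.
split => [H|<- v]; last exact: trE.
by apply: vpair_inj => v; apply: toC_inj; rewrite -trE H.
Qed.

(** [Proj] is defined by choice, so uniqueness is needed: two Hermitian idempotents [P], [Q] with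
    the same fixed vectors satisfy [Q P = P] and [P Q = Q], and taking adjoints identifies them. *)
Lemma ProjE omega : Proj iota omega =
  adj U *m diag_mx (\row_a (w a == omega)%:R) *m U.
Proof.
set P := RHS.
have cP psi : U *m (P *m psi) = diag_mx (\row_a (w a == omega)%:R) *m (U *m psi).
  by rewrite /P -!mulmxA mulmxA UU' mul1mx.
have mulU_inj (x y : 'cV[R[i]]_n) : U *m x = U *m y -> x = y.
  by move/(congr1 (mulmx (adj U))); rewrite !mulmxA U'U !mul1mx.
have PP : is_orth_proj P (weight_space iota omega).
  split => [||psi].
  - rewrite /herm /P !adjM adjK -mulmxA; congr (_ *m (_ *m _)).
    apply/matrixP => a b; rewrite adjE !mxE; have [->|_] := eqVneq a b.
      by rewrite !mulr1n conjc_nat.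
    by rewrite !mulr0n conjc0.
  - rewrite /P; set D := diag_mx _.
    have -> : adj U *m D *m U *m (adj U *m D *m U) =
        adj U *m (D *m (U *m adj U) *m D) *m U by rewrite !mulmxA.
    rewrite UU' mulmx1 mulmx_diag; congr (_ *m diag_mx _ *m _); apply/rowP => a.
    by rewrite !mxE -natrM mulnb andbb.
  - split=> [/weight_spaceP H|H].
      apply: mulU_inj; rewrite cP mul_diag_mx; apply/colP => a.
      rewrite [LHS]mxE [(\row__ _) _ _]mxE.
      by have [->|/H ->] := eqVneq ((U *m psi) a 0) 0; rewrite ?mulr0// eqxx mul1r.
    apply/weight_spaceP => a; rewrite -{1}H cP mul_diag_mx mxE [(\row__ _) _ _]mxE.
    by have [//|_] := eqVneq (w a) omega; rewrite mul0r eqxx.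
apply: xget_unique => [//|Q [QH QQ Qf]].
have [PH PPP Pf] := PP.
have absorb (A B : 'M[R[i]]_n) : A *m A = A ->
    (forall psi, weight_space iota omega psi <-> A *m psi = psi) ->
    (forall psi, weight_space iota omega psi <-> B *m psi = psi) -> B *m A = A.
  move=> AA HA HB; apply/matrixP => a b.
  have /HB/matrixP/(_ a 0) : weight_space iota omega (col b A).
    by apply/HA; rewrite colE mulmxA AA.
  by rewrite colE mulmxA -colE [LHS]mxE -colE [RHS]mxE.
have QP := absorb _ _ PPP Pf Qf; have PQ := absorb _ _ QQ Qf Pf.
by rewrite -QH -PQ adjM PH QH QP.
Qed.
End Spectral.

(** * Transfer of the constrained search to real coordinates *)

Section Transfer.
Variables (R : realType) (d n : nat) (iota : 'cV[R]_d -> 'M[R[i]]_n).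
Variables (W : 'M[R[i]]_n) (U : 'M[R[i]]_n) (w : 'I_n -> 'rV[R]_d).
Hypotheses (UU' : U *m adj U = 1%:M) (U'U : adj U *m U = 1%:M).
Hypothesis iotaE :
  forall v, iota v = adj U *m diag_mx (\row_a toC (vpair (w a) v)) *m U.
Hypothesis WH : herm W.

Let M := realmat (U *m W *m adj U).
Let B := hommx (dup w).

Lemma herm_conj : herm (U *m W *m adj U).
Proof. by rewrite /herm !adjM adjK WH mulmxA. Qed.

Lemma vnorm2_unitary (psi : 'cV[R[i]]_n) : vnorm2 (U *m psi) = vnorm2 psi.
Proof. by rewrite /vnorm2 adjM -mulmxA (mulmxA _ U) U'U mul1mx. Qed.

Lemma expect_unitary psi :
  expect W psi = bform M (realvec (U *m psi)) (realvec (U *m psi)).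
Proof.
rewrite -expectE; last exact: herm_conj.
rewrite /expect adjM -{1 2}(mul1mx psi) -{1 2}U'U !adjM adjK; congr (complex.Re (_ _ _)).
by rewrite !mulmxA.
Qed.

Lemma sqmx_hommxE (x : 'rV[R]_(n + n)) rho : sqmx x *m B = hom rho <->
  \sum_j x 0 j ^+ 2 = 1 /\ \sum_j (x 0 j ^+ 2) *: dup w j = rho.
Proof.
have -> : sqmx x *m B = row_mx (\sum_j x 0 j ^+ 2)%:M (\sum_j (x 0 j ^+ 2) *: dup w j).
  rewrite mulmx_sum_row (raddf_sum (@scalar_mx R 1)).
  rewrite (eq_bigr (fun j => row_mx (x 0 j ^+ 2)%:M (x 0 j ^+ 2 *: dup w j))); last first.
    by move=> j _; rewrite rowK /hom scale_row_mx [sqmx _ _ _]mxE scale_scalar_mx mulr1.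
  elim/big_rec3 : _ => [|i a b c _ ->]; first by rewrite row_mx0.
  by rewrite add_row_mx.
split=> [/eq_row_mx[/matrixP/(_ 0 0)]|[-> ->]//]; by rewrite !mxE eqxx !mulr1n.
Qed.

Lemma feasibleE psi rho : vnorm2 psi = 1 /\ pure_density iota psi rho <->
  sqmx (realvec (U *m psi)) *m B = hom rho.
Proof.
rewrite sqmx_hommxE -vnorm2_unitary vnorm2E.
by have pE := pure_densityE iotaE psi rho; split => -[p1 /pE p2].
Qed.

Lemma realvec_U_surj x : exists psi, realvec (U *m psi) = x.
Proof.
have [c <-] := realvec_surj x; exists (adj U *m c).
by rewrite mulmxA UU' mul1mx.
Qed.

Lemma FpE rho : Fp iota W rho = pureF M B (hom rho).
Proof.
congr inf; apply/seteqP; split => r [].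
  by move=> psi /feasibleE/= H <-; rewrite expect_unitary; exists (realvec (U *m psi)).
move=> x /= H <-; have [psi psiE] := realvec_U_surj x.
exists psi; last by rewrite expect_unitary psiE.
by apply/feasibleE; rewrite psiE.
Qed.

Lemma pure_minimizerE psi rho : pure_minimizer iota W rho psi <->
  sqmx (realvec (U *m psi)) *m B = hom rho /\
  bform M (realvec (U *m psi)) (realvec (U *m psi)) = pureF M B (hom rho).
Proof.
rewrite -FpE -expect_unitary; split => [[p1 p2 p3]|[/feasibleE[p1 p2] p3]] //.
by split => //; apply/feasibleE.
Qed.

Lemma vnorm2_Proj omega psi :
  vnorm2 (Proj iota omega *m W *m psi) =
  \sum_a (w a == omega)%:R *
    (complex.Re ((U *m W *m psi) a 0) ^+ 2 + complex.Im ((U *m W *m psi) a 0) ^+ 2).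
Proof.
rewrite (ProjE UU' U'U iotaE) -vnorm2_unitary !mulmxA UU' mul1mx vnorm2E.
rewrite big_split_ord/= -big_split/=; apply: eq_bigr => a _.
rewrite realvec_lshift realvec_rshift -!mulmxA mul_diag_mx mxE [(\row__ _) _ _]mxE.
case: (w a == omega); rewrite ?mul1r ?mul0r//=.
by rewrite !expr0n addr0.
Qed.

(** Grouping the eigenbasis by weight turns the sum over basis vectors into one over distinct
    weights. Basis vectors on the facet contribute nothing to [gradsum], since their height is 0 and
    the inverse of 0 is 0. *)
Lemma gradsumE (F : set 'rV[R]_d) S gamma psi :
  (forall j, F (w j) -> vpair (w j) S - vpair gamma S = 0) ->
  \sum_(omega \in weights iota `\` F)
     vnorm2 (Proj iota omega *m W *m psi) / (vpair omega S - vpair gamma S) =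
  gradsum M (B *m affine_form (- vpair gamma S) S) (realvec (U *m psi)).
Proof.
move=> FS; pose m a := complex.Re ((U *m W *m psi) a 0) ^+ 2 +
  complex.Im ((U *m W *m psi) a 0) ^+ 2.
pose h omega := vpair omega S - vpair gamma S.
have -> : gradsum M (B *m affine_form (- vpair gamma S) S) (realvec (U *m psi)) =
    \sum_a m a / h (w a).
  rewrite /gradsum -realvec_mul; last exact: herm_conj.
  have -> : U *m W *m adj U *m (U *m psi) = U *m W *m psi.
    by rewrite -!mulmxA (mulmxA (adj U)) U'U mul1mx.
  rewrite -(sum_dup _ (fun a => (h (w a))^-1 : R^o)); apply: eq_bigr => j _.
  rewrite hommx_affine_form [_ + vpair _ _]addrC; congr (_ * _).
  by rewrite /dup; case: fintype.split.
(* Several basis vectors may share a weight; removing duplicates lists each weight off the facet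
   once. *)
pose r := undup [seq w a | a <- enum 'I_n & w a \notin F].
rewrite (_ : weights iota `\` F = [set` r]); last first.
  rewrite (weightsE UU' U'U iotaE); apply/seteqP; split => x /=.
    move=> [[a _ <-] Fa]; rewrite mem_undup; apply: map_f.
    by rewrite mem_filter mem_enum andbT; apply/negP => /set_mem.
  rewrite mem_undup => /mapP[a]; rewrite mem_filter => /andP[/negP Fa _ ->].
  by split; [exists a|move=> Fx; apply: Fa; exact: mem_set].
rewrite -fsbig_seq ?undup_uniq//.
under eq_bigr do rewrite vnorm2_Proj mulr_suml.
rewrite exchange_big/=; apply: eq_bigr => a _; rewrite -/(m a).
have [ar|ar] := boolP (w a \in r).
  rewrite (bigD1_seq (w a))//= ?undup_uniq// eqxx mul1r big1 ?addr0// => i.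
  by rewrite eq_sym => /negbTE ->; rewrite !mul0r.
have Fa : F (w a).
  apply: contrapT => Fa; move/negP: ar; apply; rewrite mem_undup; apply: map_f.
  by rewrite mem_filter mem_enum andbT; apply/negP => /set_mem.
rewrite /h (FS _ Fa) invr0 mulr0 big1_seq// => i /andP[_ ir].
by case: eqP ar => [->|_ _]; rewrite ?ir// !mul0r.
Qed.

End Transfer.

(** * The square-root law for the pure functional of an abelian theory *)

Unset Implicit Arguments.

Theorem theorem4p20 (R : realType) (d n : nat)
  (iota : 'cV[R]_d -> 'M[R[i]]_n) (W : 'M[R[i]]_n)
  (F : set 'rV[R]_d) (k : nat)
  (rho_s eta gamma : 'rV[R]_d) (S : 'cV[R]_d) :
  functional_theory iota W ->
  abelian_theory iota ->
  facet (convh (weights iota)) F ->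
  affdim F k ->
  F rho_s ->
  (forall s : seq 'rV[R]_d, size s = k ->
     {in s, forall w, (weights iota `&` F) w} -> ~ conv_seq s rho_s) ->
  trans_space (affh (weights iota)) eta ->
  (exists2 e0 : R, 0 < e0 &
     forall e : R, 0 <= e <= e0 -> convh (weights iota) (rho_s + e *: eta)) ->
  (forall alpha, trans_space (affh F) alpha -> vpair alpha S = 0) ->
  vpair eta S = 1 ->
  affh F gamma ->
  let rhs := fun phi : 'cV[R[i]]_n =>
    - 2 * Num.sqrt (\sum_(omega \in weights iota `\` F)
         vnorm2 (Proj iota omega *m W *m phi) /
           (vpair omega S - vpair gamma S)) in
  exists phi : 'cV[R[i]]_n,
    [/\ pure_minimizer iota W rho_s phi,
        (forall phi', pure_minimizer iota W rho_s phi' -> rhs phi <= rhs phi') &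
        (fun e : R => (Fp iota W (rho_s + e *: eta) - Fp iota W rho_s)
                        / Num.sqrt e) @ 0^'+ --> rhs phi].
Proof.
move=> [iL iH WH] iA; have [U [w [UU' U'U iotaE]]] := joint_spectrum iL iH iA.
have wE := weightsE UU' U'U iotaE; rewrite -range_dup in wE.
rewrite wE => facF dimF Frho gen etaT inw SF etaS Fgamma.
have [fd hF] := facet_dataP facF dimF Frho gen etaT inw SF etaS Fgamma.
have FS j : F (w j) -> vpair (w j) S - vpair gamma S = 0.
  by rewrite -(dup_lshift w j) => /hF; rewrite hommx_affine_form addrC.
have grad := gradsumE UU' U'U iotaE WH _ FS.
rewrite -wE => rhs.
have rhsE phi : rhs phi = - 2 * Num.sqrt (gradsum (realmat (U *m W *m adj U))
    (hommx (dup w) *m affine_form (- vpair gamma S) S) (realvec (U *m phi))).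
  by rewrite /rhs grad.
have feas : exists x, sqmx x *m hommx (dup w) = hom rho_s.
  apply: convh_hommx; have [e0 e00 inw'] := inw.
  by have := inw' 0; rewrite scale0r addr0; apply; rewrite lexx ltW.
have [x [xB xF xmax xlim]] := pureF_facet fd (realmat_sym (herm_conj U WH)) feas.
have [phi phiE] := realvec_U_surj UU' x.
have minE := pure_minimizerE UU' U'U iotaE WH.
exists phi; split.
- by apply/minE; rewrite phiE.
(* The factor [- 2] reverses the order, so the largest [gradsum] gives the smallest right-hand
   side. *)
- move=> phi' /minE[pB pF]; rewrite !rhsE phiE !mulNr lerN2 ler_pM2l//.
  by rewrite ler_wsqrtr// xmax.
- rewrite rhsE phiE.
  have -> : (fun e : R => (Fp iota W (rho_s + e *: eta) - Fp iota W rho_s) / Num.sqrt e) =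
    (fun e : R => (pureF (realmat (U *m W *m adj U)) (hommx (dup w))
        (hom rho_s + e *: row_mx 0 eta) -
      pureF (realmat (U *m W *m adj U)) (hommx (dup w)) (hom rho_s)) / Num.sqrt e).
    apply/funext => e; rewrite !(FpE UU' U'U iotaE WH).
    by rewrite {1}/hom scale_row_mx add_row_mx scaler0 addr0.
  exact: xlim.
Qed.
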